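(* Let $n\ge 2$, $\mu,\nu\in\mathbb{R}$ and $p>1$. Let $\varepsilon>0$ and let $g=g(|x|)$ be a radial smooth function on $\mathbb{R}^n$ satisfying $$g(|x|)\ge \frac{M}{(1+|x|)^{\bar k+1}}\quad\text{for any } x\in\mathbb{R}^n,$$ for some $M>0$ and some $\bar k>-1$. Assume in addition that $$\bar k+\frac{\mu}{2}>0,\qquad \frac{\mu}{2}\left(\frac{\mu}{2}-1\right)\ge \nu,\qquad 1<p<p_F\left(\bar k+\frac{\mu}{2}\right).$$ Then the classical solution $v$ of the Cauchy problem $$\begin{cases} v_{tt}(t,x)-\Delta v(t,x)+\dfrac{\mu}{1+t}v_t(t,x)+\dfrac{\nu}{(1+t)^2}v(t,x)=|v(t,x)|^p, & t\ge 0,\ x\in\mathbb{R}^n,\\ v(0,x)=0,\\ v_t(0,x)=\varepsilon g(x)\end{cases}$$ blows up. More precisely, the lifespan $T(\varepsilon)>0$ of the solution is finite and satisfies $$T(\varepsilon)\le C\,\varepsilon^{-\frac{2(p-1)}{4-(\mu+2\bar k)(p-1)}},$$ with a constant $C>0$ independent of $\varepsilon$.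
   Context: For $h>0$, the Fujita-type exponent is $p_F(h):=1+\frac{2}{h}$. The lifespan of the solution is the maximal existence time, as a function of $\varepsilon$: $$T(\varepsilon):=\sup\{T>0 \text{ such that the local solution of the Cauchy problem is defined on } [0,T)\times\mathbb{R}^n\}.$$
   Formalization: The constant C is independent of ε only on each bounded range 0 < ε ≤ ε₀ (ε₀ arbitrary, C depending on ε₀), since a bound uniform over all ε > 0 fails as ε → ∞; existence of a local classical solution is assumed. *)

(* Defs.v *)
(* MathComp-Analysis; the reals are an arbitrary [R : realType]. *)
From HB Require Import structures.
From mathcomp Require Import all_boot all_order all_algebra.
From mathcomp Require Import all_classical all_reals all_analysis.

Set Implicit Arguments.
Unset Strict Implicit.
Unset Printing Implicit Defensive.

Import Order.TTheory GRing.Theory Num.Theory.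
Import numFieldNormedType.Exports.

Local Open Scope classical_set_scope.
Local Open Scope ring_scope.

Section SpaceDerivatives.
Context {R : realType} {n : nat}.
Implicit Types (f : 'rV[R]_n -> R) (x : 'rV[R]_n) (i : 'I_n).

(* The library norm on ['rV[R]_n] is the sup norm (it induces the same
   topology), hence a separate Euclidean norm. *)
Definition enorm x : R := Num.sqrt (\sum_(i < n) x 0 i ^+ 2).

Definition derivable_x i f x : Prop := derivable f x (delta_mx 0 i).

Definition dx i f x : R := 'D_(delta_mx 0 i) f x.

Definition laplacian f x : R := \sum_(i < n) dx i (dx i f) x.

Fixpoint Ck (k : nat) f : Prop :=
  continuous f /\
  match k with
  | 0%N => True
  | k'.+1 => forall i, (forall x, derivable_x i f x) /\ Ck k' (dx i f)
  end.

Definition smooth f : Prop := forall k, Ck k f.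

End SpaceDerivatives.

Section TimeDerivative.
Context {R : realType} {n : nat}.
Implicit Types (u v : R -> 'rV[R]_n -> R) (t T : R) (x : 'rV[R]_n).

Definition time_quotient u t x (s : R) : R := (u s x - u t x) / (s - t).

(* Restricting to [0 <= s] makes the derivative in time one-sided at [t = 0],
   and the usual two-sided one at [t > 0]. *)
Definition time_filter t : set_system R := within [set s | 0 <= s] t^'.

Definition derivable_t u t x : Prop := cvg (time_quotient u t x @ time_filter t).

Definition dt u t x : R := lim (time_quotient u t x @ time_filter t).

Definition strip T : set (R * 'rV[R]_n) := [set z | 0 <= z.1 < T].

(* [u] is of class C^k on [0,T) x R^n, up to and including [t = 0]. *)
Fixpoint Ck_strip (k : nat) T u : Prop :=
  {within strip T, continuous (fun z : R * 'rV[R]_n => u z.1 z.2)} /\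
  match k with
  | 0%N => True
  | k'.+1 =>
      ((forall t x, 0 <= t < T -> derivable_t u t x) /\
       Ck_strip k' T (dt u)) /\
      (forall i,
         (forall t x, 0 <= t < T -> derivable_x i (u t) x) /\
         Ck_strip k' T (fun t => dx i (u t)))
  end.

(* Classical solution on [0,T) x R^n of the Cauchy problem
     v_tt - Delta v + mu/(1+t) v_t + nu/(1+t)^2 v = |v|^p,
     v(0,.) = 0,  v_t(0,.) = v1. *)
Record classical_solution (mu nu p : R) (v1 : 'rV[R]_n -> R) T v : Prop := {
  classical_C2 : Ck_strip 2 T v;
  classical_eq : forall t x, 0 <= t < T ->
    dt (dt v) t x - laplacian (v t) x
      + mu / (1 + t) * dt v t x + nu / (1 + t) ^+ 2 * v t x
    = `|v t x| `^ p;
  classical_v0 : forall x, v 0 x = 0;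
  classical_v1 : forall x, dt v 0 x = v1 x
}.

(* For [1 < p] classical solutions are unique, so [T] belongs to this set exactly when the
   local solution is defined on [0,T) x R^n. *)
Definition existence_times (mu nu p : R) (g : 'rV[R]_n -> R) (eps : R) : set R :=
  [set T | 0 < T /\
     exists v, classical_solution mu nu p (fun x => eps * g x) T v].

(* The supremum is taken in [0,+oo]: it is 0 if there is no local solution. *)
Definition lifespan (mu nu p : R) (g : 'rV[R]_n -> R) (eps : R) : \bar R :=
  ereal_sup (0%E |` EFin @` existence_times mu nu p g eps).

End TimeDerivative.

Definition p_F {R : realType} (h : R) : R := 1 + 2 / h.

(* Main.v *)
(* The Liouville transform [u = (1 + t)^(mu/2) v] turns the equation into
   [u_tt - Laplacian u + c u / (1 + t)^2 = (1 + t)^(- mu (p - 1) / 2) |u|^p] with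
   [c = nu - mu/2 (mu/2 - 1) <= 0].  Test it against a compactly supported [psi >= 0] of scale [T]
   in both variables and absorb [u E(psi)], where [E] is the adjoint operator, by Young's
   inequality.  On a ball of radius [T] the data contribute [eps T^(n - k - 1)], the error is
   [T^(n - 1 - 2 / (p - 1) + mu/2)], and comparing the two gives the bound on [T].

   When [mu] is very negative the weight of [|u|^p] is so small at early times that
   [E(psi) = O(T^-2)] does not suffice: [psi] must solve the adjoint equation to high order in
   [s = (1 + t) / T].  The function [s^al], with [al <= 0] and [al (al - 1) = - c], removes the
   potential, and [psi] is a flat cutoff times the expansion [sum_j F_j(s) Laplacian^j rho^-l] in
   [rho = 1 + |x|^2 / T^2], where [F_0 = s^al] and [F_(j+1)'' + c F_(j+1) / s^2 = F_j].

   All integrals are replaced by sums over a lattice whose mesh tends to 0: second differences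
   are second derivatives at intermediate points, summation by parts is exact, and uniform
   continuity on a box takes care of the rest. *)
Require Import Defs.
From HB Require Import structures.
From mathcomp Require Import all_boot all_order all_algebra.
From mathcomp Require Import all_classical all_reals all_analysis.
From mathcomp Require Import ring lra zify.

Set Implicit Arguments.
Unset Strict Implicit.
Unset Printing Implicit Defensive.

Import Order.TTheory GRing.Theory Num.Theory.
Import numFieldNormedType.Exports.
Local Open Scope classical_set_scope.
Local Open Scope ring_scope.

(** * Calculus *)

(** The hypothesis on [nu] is the sign [c <= 0]. It provides an indicial root [al <= 0], hence
    [s^al >= 1] for [s <= 1], and so [psi] stays bounded below at [t = 0], where [s = 1 / T] tends
    to 0; this lets the data enter with their full mass. A cutoff in space alone would spoil the
    accuracy at early times, because its derivatives do not decay as [s] tends to 0. The cutoff is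
    therefore a function of the single product [s rho]: at early times it acts only where [rho] is
    large, and the powers of [rho] that its derivatives cost are repaid by a large [l]. The support
    widens as [s] decreases, but it stays inside [|x_i| < T^2]. Young's inequality divides by a
    power of [psi], so the cutoff is also a high power of its defining function: [E(psi)] then
    vanishes fast enough at the edge of the support. The final comparison reads [eps <= C T^(- th)]
    with [th = 2 / (p - 1) - k - mu / 2], which is positive exactly when [p] is below the
    Fujita-type exponent. *)

Lemma powR_young (R : realType) (p x e A : R) : 1 < p -> 0 <= x -> 0 <= e -> 0 < A ->
  x * e <= A * x `^ p + e * (e / A) `^ (p - 1)^-1.
Proof.
move=> p1 x0 e0 A0.
have p10 : 0 < p - 1 by rewrite subr_gt0.
(* Either [e <= A x^(p - 1)] and the first term alone dominates, or [x < (e / A)^(1 / (p - 1))] and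
   the second does. *)
have [h|h] := leP e (A * x `^ (p - 1)).
  apply: (@le_trans _ _ (A * x `^ p)); last by rewrite lerDl mulr_ge0// powR_ge0.
  rewrite -(mulr_powRB1 x0 (lt_trans ltr01 p1)) mulrCA.
  by rewrite ler_wpM2l.
apply: (@le_trans _ _ (e * (e / A) `^ (p - 1)^-1)); last first.
  by rewrite lerDr mulr_ge0 ?powR_ge0// ltW.
rewrite mulrC ler_wpM2l//.
have -> : x = (x `^ (p - 1)) `^ (p - 1)^-1.
  by rewrite -powRrM divff ?gt_eqF// powRr1.
rewrite ge0_ler_powR ?nnegrE ?powR_ge0 ?divr_ge0 ?invr_ge0 ?(ltW p10) ?(ltW A0)//.
by rewrite ler_pdivlMr// mulrC ltW.
Qed.

Lemma within_continuous_comp (S T U : topologicalType) (A : set S) (B : set T)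
    (g : S -> T) (f : T -> U) :
  {within A, continuous g} -> (forall x, A x -> B (g x)) ->
  {within B, continuous f} -> {within A, continuous (f \o g)}.
Proof.
move=> /subspace_continuousP cg AB /subspace_continuousP cf.
apply/subspace_continuousP => x Ax P Pfx.
have H : \forall y \near x, A y -> B (g y) -> P (f (g y)) := cg _ Ax _ (cf _ (AB _ Ax) _ Pfx).
have H' : \forall y \near x, A y -> P (f (g y)).
  by near=> y => Ay; have := AB _ Ay; move: Ay; near: y.
exact: H'.
Unshelve. all: by end_near. Qed.

(** Rolle's argument: [c] is the second difference quotient, so [g h = g 0], and some [y] satisfies
    [f1 (a + y) - f1 (a - y) = 2 c y]; the mean value theorem for [f1] on [[a - y, a + y]] then
    yields [xi]. At the endpoints only continuity of [f] enters, so the interval may begin at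
    [t = 0], where time derivatives are one-sided. *)
Lemma second_difference_mean (R : realType) (f f1 f2 : R -> R) (a h : R) : 0 < h ->
  {within `[a - h, a + h], continuous f} ->
  (forall x, x \in `]a - h, a + h[%R -> is_derive x 1 f (f1 x)) ->
  (forall x, x \in `]a - h, a + h[%R -> is_derive x 1 f1 (f2 x)) ->
  exists2 xi, xi \in `]a - h, a + h[%R &
    f (a + h) - 2 * f a + f (a - h) = h ^+ 2 * f2 xi.
Proof.
move=> h0 fc fd f1d.
pose c := (f (a + h) - 2 * f a + f (a - h)) / h ^+ 2.
pose g (y : R) := f (a + y) + f (a - y) - c * y ^+ 2.
have inDo y : y \in `]0, h[%R -> a + y \in `]a - h, a + h[%R /\ a - y \in `]a - h, a + h[%R.
  by rewrite !in_itv/=; lra.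
have dg y : y \in `]0, h[%R -> is_derive y 1 g (f1 (a + y) - f1 (a - y) - 2 * c * y).
  move=> /inDo[yp ym].
  have d1 : is_derive y 1 (f \o (fun y : R => a + y)) (f1 (a + y) * 1).
    apply: is_derive1_comp; first exact: fd.
    by apply: trigger_derive; rewrite /GRing.scale /=; ring.
  have d2 : is_derive y 1 (f \o (fun y : R => a - y)) (f1 (a - y) * (-1)).
    apply: is_derive1_comp; first exact: fd.
    by apply: trigger_derive; rewrite /GRing.scale /=; ring.
  apply: trigger_derive.
  rewrite /GRing.scale /=; ring.
have shift (e : R) : {within `[0, h], continuous (fun y : R => a + e * y)}.
  apply: continuous_subspaceT => x; apply: cvgD; first exact: cvg_cst.
  by apply: cvgM; [exact: cvg_cst|exact: cvg_id].
have gc : {within `[0, h], continuous g}.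
  have /subspace_continuousP c1 : {within `[0, h], continuous (f \o (fun y : R => a + 1 * y))}.
    apply: within_continuous_comp fc; first exact: shift.
    by move=> x /=; rewrite !in_itv/=; lra.
  have /subspace_continuousP c2 : {within `[0, h], continuous (f \o (fun y : R => a + -1 * y))}.
    apply: within_continuous_comp fc; first exact: shift.
    by move=> x /=; rewrite !in_itv/=; lra.
  have -> : g = (fun y => f (a + 1 * y) + f (a + -1 * y) - c * y ^+ 2).
    by apply/funext => y; rewrite /g mul1r mulN1r.
  apply/subspace_continuousP => x xh; apply: cvgB.
    by apply: cvgD; [exact: c1|exact: c2].
  apply: cvgM; first exact: cvg_cst.
  by apply: cvg_within_filter; exact: exprn_continuous.
have [y yh] := MVT h0 dg gc.
have -> : g h - g 0 = 0 by rewrite /g /c addr0 subr0; field; lra.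
rewrite subr0 => gy.
have [ypm ymm] := inDo _ yh; move: yh ypm ymm; rewrite !in_itv/= => yh ypm ymm.
have sub x : x \in `]a - y, a + y[%R -> x \in `]a - h, a + h[%R.
  by rewrite !in_itv/=; lra.
have yy : a - y < a + y by lra.
have d1 x : x \in `]a - y, a + y[%R -> is_derive x 1 f1 (f2 x) by move=> /sub; exact: f1d.
have c1 : {within `[a - y, a + y], continuous f1}.
  apply: derivable_within_continuous => x; rewrite in_itv/= => xy.
  by have [] : is_derive x 1 f1 (f2 x) by apply: f1d; rewrite in_itv/=; lra.
have [xi xiy] := MVT yy d1 c1.
move=> f1E; exists xi; first exact: sub.
have : (f2 xi - c) * (2 * y * h) = 0.
  by rewrite [RHS]gy f1E; ring.
move/eqP; rewrite mulf_eq0 => /orP[|/eqP]; last by nra.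
by rewrite subr_eq0 => /eqP ->; rewrite /c; field; lra.
Qed.

Lemma compact_uniformly_continuous (R : realType) (V : pseudoMetricType R)
    (K : set V) (f : V -> R) : compact K -> {within K, continuous f} ->
  forall eta : R, 0 < eta -> exists2 d : R, 0 < d &
    forall x y, K x -> K y -> ball x d y -> `|f x - f y| < eta.
Proof.
move=> /compact_near_coveringP cK /subspace_continuousP cf eta eta0.
have e2 : 0 < eta / 2 by lra.
have := cK R (nbhs (0:R)^'+) (fun d x => K x -> forall y, K y -> ball x d y -> `|f x - f y| < eta).
case.
  move=> x Kx.
  have /cvgrPdist_lt/(_ _ e2) /nbhs_ballP[r /= r0 hr] := cf x Kx.
  have r2 : 0 < r / 2 by lra.
  exists (ball x (r / 2), [set d | d < r / 2]).
    split; first exact: nbhsx_ballx.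
    exact: nbhs_right_lt.
  move=> [z d] /= [xz dr] Kz y Ky zy.
  have xy : ball x r y.
    by rewrite (splitr r); apply: ball_triangle xz _; apply: le_ball zy; exact: ltW.
  have h1 := hr _ xy Ky.
  have h2 : `|f x - f z| < eta / 2.
    by apply: hr => //; apply: le_ball xz; lra.
  rewrite (splitr eta) -(subrK (f x) (f z)) -addrA.
  by rewrite (le_lt_trans (ler_normD _ _))// ltrD// distrC.
move=> d /= d0 hd; exists (d / 2); first lra.
move=> x y Kx Ky xy; apply: (hd (d / 2)) xy => //=; last lra.
by rewrite sub0r normrN gtr0_norm; lra.
Qed.

(** The exponent is at least 2, so the difference quotient at 0 is [O(|h|)]. Used twice, this makes
    the cutoff, whose exponent is at least 3, of class C^2. *)
Lemma is_derive_pospart_exp (R : realType) (m : nat) (x : R) :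
  is_derive x 1 (fun y : R => Num.max y 0 ^+ m.+2) (m.+2%:R * Num.max x 0 ^+ m.+1).
Proof.
have [x0|x0|->] := ltgtP x 0.
- apply: (@near_eq_is_derive _ _ _ (cst 0)).
    near=> y; rewrite /cst max_r ?expr0n// ltW//.
    by near: y; exact: lt_nbhsl.
  by rewrite expr0n/= mulr0; exact: is_derive_cst.
- apply: (@near_eq_is_derive _ _ _ (fun y : R => y ^+ m.+2)).
    near=> y; rewrite max_l// ltW//.
    by near: y; exact: lt_nbhsr.
  split; first exact: exprn_derivable.
  by rewrite exp_derive /GRing.scale/= mulr1.
- rewrite expr0n/= mulr0.
  have : (fun h : R => h^-1 *: ((fun y : R => Num.max y 0 ^+ m.+2) (h *: 1 + 0)
    - (fun y : R => Num.max y 0 ^+ m.+2) 0)) @ 0^' --> (0:R).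
    apply/cvgrPdist_lt => e e0.
    near=> h.
    have h0 : h != 0 by near: h; exact: nbhs_dnbhs_neq.
    have he : `|h| < Num.min e 1.
      near: h; apply: dnbhs0_lt; rewrite lt_min e0; lra.
    move: he; rewrite lt_min => /andP[he h1].
    rewrite sub0r normrN /GRing.scale /= mulr1 addr0 maxxx expr0n/= subr0 normrM normfV.
    rewrite normrX ltr_pdivrMl ?normr_gt0//.
    apply: (@le_lt_trans _ _ (`|h| ^+ m.+2)).
      by rewrite lerXn2r ?nnegrE// /Num.max; case: ifP; rewrite ?normr0.
    rewrite exprS ltr_pM2l ?normr_gt0// exprS.
    apply: le_lt_trans he; rewrite ler_piMr// exprn_ile1//; lra.
  move=> h; split; first by apply/cvg_ex; exists 0.
  exact/cvg_lim.
Unshelve. all: by end_near. Qed.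

(** * The test function *)

(** This class is closed under [d/ds] and contains all the [F_j]; the logarithm takes care of the
    one possible resonance in their recursion. *)
Definition logpow (R : realType) (b A B s : R) : R := s `^ b * (A * ln s + B).

Lemma is_derive_logpow (R : realType) (b A B s : R) : 0 < s ->
  is_derive s 1 (logpow b A B) (logpow (b - 1) (b * A) (b * B + A) s).
Proof.
move=> s0; have d1 := is_derive1_powR b s0; have d2 := is_derive1_ln s0.
rewrite /logpow; apply: trigger_derive.
have -> : s `^ (b - 1) = s `^ b / s.
  by rewrite powRB ?powRr1 ?(ltW s0)// [s == 0]gt_eqF// implybT.
by rewrite /GRing.scale /=; field; rewrite gt_eqF.
Qed.

(* The test function depends on [x] through [r = 1 + |x|^2] only; it is a polynomial in [1 / r]
   because such functions dominate their own Laplacians up to a constant. *)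
Definition invpoly (R : realType) (p : {poly R}) (r : R) : R := p.[r^-1].

(** The chain rule for [p (1 / r)] gives the polynomial [- X^2 p']; it is associated as [X (X p')]
    because divisibility is tracked through [X p']. *)
Definition dinv (R : realType) (p : {poly R}) : {poly R} := - ('X * ('X * p^`())).

Lemma is_derive_invpoly (R : realType) (p : {poly R}) (r : R) : r != 0 ->
  is_derive r 1 (invpoly p) (invpoly (dinv p) r).
Proof.
move=> r0.
have d1 : is_derive r 1 (fun y : R => y^-1) (- r ^- 2 *: 1).
  exact: is_deriveV.
have d2 := is_derive1_comp (is_derive_poly p r^-1) d1.
apply: (trigger_derive d2).
rewrite /invpoly /dinv !hornerE /GRing.scale /=.
by field.
Qed.

(** For a function [f] of [r = 1 + |x|^2] the Laplacian in [x] is [4 (r - 1) f'' + 2 n f']. In the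
    variable [X = 1 / r] the factor [r - 1] is [(1 - X) / X], and its denominator cancels against
    the [X^2] of [dinv], so the result is again a polynomial. *)
Definition radial_laplacian (R : realType) (n : nat) (p : {poly R}) : {poly R} :=
  4 *: ((1 - 'X) * ('X * ('X * ('X * p^`()))^`())) - (2 * n)%:R *: ('X * ('X * p^`())).

Lemma invpoly_radial_laplacian (R : realType) (n : nat) (p : {poly R}) (r : R) : r != 0 ->
  invpoly (radial_laplacian n p) r =
  4 * (r - 1) * invpoly (dinv (dinv p)) r + (2 * n)%:R * invpoly (dinv p) r.
Proof.
move=> r0; rewrite /invpoly /dinv /radial_laplacian derivN.
rewrite !(hornerM, hornerD, hornerN, hornerZ, hornerX, hornerC).
by field.
Qed.

(** Divisibility by [X^l] encodes the decay [r^-l]. It survives [X p'], hence also the derivative in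
    [r] and the Laplacian. *)
Lemma multXn_deriv (R : realType) (l : nat) (p : {poly R}) :
  'X^l %| p -> 'X^l %| 'X * p^`().
Proof.
move=> /dvdpP[q ->]; rewrite derivM derivXn mulrDr dvdp_add//.
  by rewrite mulrA dvdp_mulIr.
case: l => [|l]; first by rewrite expr0 dvd1p.
by rewrite /= -mulr_natr exprS !mulrA [_ * q]mulrC -!mulrA dvdp_mull// mulrA dvdp_mulr.
Qed.

Lemma multXn_dinv (R : realType) (l : nat) (p : {poly R}) :
  'X^l %| p -> 'X^l %| dinv p.
Proof. by move=> h; rewrite /dinv dvdpNr dvdp_mull// multXn_deriv. Qed.

Lemma multXn_radial_laplacian (R : realType) (l n : nat) (p : {poly R}) :
  'X^l %| p -> 'X^l %| radial_laplacian n p.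
Proof.
move=> h; have h1 : 'X^l %| 'X * ('X * p^`()) by rewrite dvdp_mull// multXn_deriv.
rewrite /radial_laplacian dvdp_sub// -mul_polyC dvdp_mull//.
by rewrite dvdp_mull// multXn_deriv.
Qed.

Lemma invpoly_bound (R : realType) (l : nat) (p : {poly R}) : 'X^l %| p ->
  exists2 C : R, 0 <= C & forall r, 1 <= r -> `|invpoly p r| <= C * r^-1 ^+ l.
Proof.
move=> /dvdpP[q ->]; exists (\sum_(i < size q) `|q`_i|); first exact: sumr_ge0.
move=> r r1; have r0 : 0 < r by lra.
rewrite /invpoly hornerM hornerXn normrM (ger0_norm (exprn_ge0 _ _)) ?invr_ge0 ?(ltW r0)//.
rewrite ler_wpM2r ?exprn_ge0 ?invr_ge0 ?(ltW r0)// horner_coef.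
apply: le_trans (ler_norm_sum _ _ _) _; apply: ler_sum => i _.
rewrite normrM ler_piMr// ger0_norm ?exprn_ge0 ?invr_ge0 ?(ltW r0)//.
by rewrite exprn_ile1 ?invr_ge0 ?(ltW r0)// invf_le1.
Qed.

(** One unit of the exponent pays for the logarithm: [|s ln s| <= 1] on [(0, 1]], since
    [ln (1 / s) <= 1 / s - 1]. *)
Lemma logpow_bound (R : realType) (b A B b0 : R) : b0 + 1 <= b ->
  forall s, 0 < s <= 1 -> `|logpow b A B s| <= (`|A| + `|B|) * s `^ b0.
Proof.
move=> bb s /andP[s0 s1]; rewrite /logpow normrM (ger0_norm (powR_ge0 _ _)).
have l1 : `|s * ln s| <= 1.
  have := @le_ln1Dx R (s^-1 - 1); rewrite addrCA subrr addr0 lnV ?posrE// => h.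
  have ls : ln s <= 0 by exact: ln_le0.
  have si : 0 < s^-1 by rewrite invr_gt0.
  rewrite normrM (gtr0_norm s0) (ler0_norm ls) -ler_pdivlMl// mulr1.
  have : - ln s <= s^-1 - 1 by apply: h; lra.
  lra.
have -> : s `^ b = s `^ (b - 1) * s.
  have -> : s `^ b = s `^ (b - 1) * s `^ 1.
    by rewrite -powRD ?subrK// [s == 0]gt_eqF// implybT.
  by rewrite powRr1 ?ltW.
rewrite -mulrA; have -> : s * `|A * ln s + B| = `|A * (s * ln s) + s * B|.
  by rewrite -{1}(gtr0_norm s0) -normrM; congr `|_|; ring.
rewrite mulrC ler_pM ?powR_ge0//.
  apply: le_trans (ler_normD _ _) _; rewrite !normrM lerD//.
    by rewrite -normrM ler_piMr.
  by rewrite ler_piMl// gtr0_norm.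
by apply: ger_powR; [rewrite s0|lra].
Qed.

(* [(b - 1) b = al (al - 1)] for at most one [b = al + 2 (j + 1)], the other root [1 - al] of the
   indicial equation; only from there on do logarithms occur. *)
Lemma logpow_coefficients (R : realType) (al : R) : al <= 0 ->
  exists A B : nat -> R, [/\ A 0%N = 0, B 0%N = 1 &
    forall j, let b := al + 2 * j.+1%:R in
      (b - 1) * (b * A j.+1) - al * (al - 1) * A j.+1 = A j /\
      (b - 1) * (b * B j.+1 + A j.+1) + b * A j.+1 - al * (al - 1) * B j.+1 = B j].
Proof.
move=> al0.
pose b j : R := al + 2 * j.+1%:R.
pose m j := b j * (b j - 1) - al * (al - 1).
(* [m j] is the indicial polynomial at [b j]. At a resonance [m j = 0] the second equation becomes
   [(2 b - 1) A = B j], which fixes the logarithmic coefficient, while the other one is free and set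
   to 0. *)
pose step j (c : R * R) : R * R :=
  if m j == 0 then (c.2 / (2 * b j - 1), 0)
  else (c.1 / m j, (c.2 - (2 * b j - 1) * (c.1 / m j)) / m j).
pose fix AB (j : nat) : R * R := if j is i.+1 then step i (AB i) else (0, 1).
have mE j : m j = 2 * j.+1%:R * (2 * al + 2 * j%:R + 1).
  by rewrite /m /b -natr1; ring.
(* A logarithm is present only after the resonance [2 al + 2 i + 1 = 0], and from then on
   [2 al + 2 j - 1 >= 0]. So no second resonance occurs, and at the first one [A j = 0], as the
   first equation demands. *)
have inv j : (AB j).1 = 0 \/ 0 <= 2 * al + 2 * j%:R - 1.
  elim: j => [|j IH]; first by left.
  rewrite /= /step; case: eqVneq => [mj|mj] /=; last first.
    by case: IH => [->|h]; [left; rewrite mul0r|right; rewrite -natr1; lra].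
  right; move: mj; rewrite mE => /eqP; rewrite !mulf_eq0 !pnatr_eq0 /= => /eqP h.
  by rewrite -natr1; lra.
exists (fun j => (AB j).1), (fun j => (AB j).2); split => // j /=.
rewrite -/(b j) /step; case: eqVneq => [mj|mj] /=.
  have j0 : 0 <= j%:R :> R by [].
  have hj : 2 * al + 2 * j%:R + 1 = 0.
    move: (mj); rewrite mE => /eqP; rewrite !mulf_eq0 !pnatr_eq0 /=; exact/eqP.
  have A0 : (AB j).1 = 0 by case: (inv j) => // ; lra.
  have bj : 2 * b j - 1 != 0.
    by apply/lt0r_neq0; rewrite /b -natr1; lra.
  have e : b j * (b j - 1) = al * (al - 1) by move/eqP: mj; rewrite subr_eq0 => /eqP.
  split.
    by rewrite A0 mulrCA mulrA e subrr.
  by rewrite mulr0 add0r; field.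
split; rewrite /m in mj *; field; exact: mj.
Qed.

(** Exponents, coefficients and polynomials are all parameters, so that every derivative is again an
    instance, and one bound and one continuity proof serve all of them. *)
Definition logpoly_sum (R : realType) (N : nat) (b A B : nat -> R) (p : nat -> {poly R})
    (s r : R) : R :=
  \sum_(j < N.+1) logpow (b j) (A j) (B j) s * invpoly (p j) r.

Lemma is_derive_logpoly_sum_l (R : realType) N (b A B : nat -> R) p (s r : R) : 0 < s ->
  is_derive s 1 (fun s => logpoly_sum N b A B p s r)
    (logpoly_sum N (fun j => b j - 1) (fun j => b j * A j) (fun j => b j * B j + A j) p s r).
Proof.
move=> s0; rewrite /logpoly_sum.
have -> : (fun s => \sum_(j < N.+1) logpow (b j) (A j) (B j) s * invpoly (p j) r) =
   \sum_(j < N.+1) (fun s => logpow (b j) (A j) (B j) s * invpoly (p j) r).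
  by apply/funext => x; rewrite fct_sumE.
apply: is_derive_sum => j.
have d := @is_derive_logpow R (b j) (A j) (B j) s s0.
apply: trigger_derive; rewrite /GRing.scale/=; ring.
Qed.

Lemma is_derive_logpoly_sum_r (R : realType) N (b A B : nat -> R) p (s r : R) : r != 0 ->
  is_derive r 1 (fun r => logpoly_sum N b A B p s r)
    (logpoly_sum N b A B (fun j => dinv (p j)) s r).
Proof.
move=> r0; rewrite /logpoly_sum.
have -> : (fun r => \sum_(j < N.+1) logpow (b j) (A j) (B j) s * invpoly (p j) r) =
   \sum_(j < N.+1) (fun r => logpow (b j) (A j) (B j) s * invpoly (p j) r).
  by apply/funext => x; rewrite fct_sumE.
apply: is_derive_sum => j.
have d := @is_derive_invpoly R (p j) r r0.
apply: trigger_derive; rewrite /GRing.scale/=; ring.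
Qed.

Lemma is_derive_continuous (R : realType) (f : R -> R) (x d : R) :
  is_derive x 1 f d -> {for x, continuous f}.
Proof. by move=> h; apply/differentiable_continuous/derivable1_diffP. Qed.

Lemma logpoly_sum_continuous (R : realType) N (b A B : nat -> R) p (z : R * R) :
  0 < z.1 -> z.2 != 0 ->
  {for z, continuous (fun z : R * R => logpoly_sum N b A B p z.1 z.2)}.
Proof.
move=> s0 r0; rewrite /logpoly_sum /prop_for /continuous_at.
apply: cvg_big => [|j _]; first exact: add_continuous.
apply: cvgM.
  apply: (@continuous_comp _ _ _ fst (logpow (b j) (A j) (B j))); first exact: cvg_fst.
  exact: (is_derive_continuous (is_derive_logpow _ _ _ s0)).
apply: (@continuous_comp _ _ _ snd (invpoly (p j))); first exact: cvg_snd.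
exact: (is_derive_continuous (is_derive_invpoly _ r0)).
Qed.

Lemma logpoly_sum_bound (R : realType) N (b A B : nat -> R) p (l : nat) (b0 : R) :
  (forall j, b0 + 1 <= b j) -> (forall j, 'X^l %| p j) ->
  exists2 C : R, 0 <= C & forall s r, 0 < s <= 1 -> 1 <= r ->
    `|logpoly_sum N b A B p s r| <= C * s `^ b0 * r^-1 ^+ l.
Proof.
move=> hb hp.
elim: N => [|N [C C0 IH]].
  have [C C0 hC] := invpoly_bound (hp 0%N).
  exists ((`|A 0%N| + `|B 0%N|) * C); first by rewrite mulr_ge0// addr_ge0.
  move=> s r hs hr; rewrite /logpoly_sum big_ord1 normrM.
  rewrite -[leRHS]mulrA mulrACA.
  by rewrite ler_pM// ?hC// logpow_bound.
have [C' C'0 hC] := invpoly_bound (hp N.+1).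
exists (C + (`|A N.+1| + `|B N.+1|) * C').
  by rewrite addr_ge0// mulr_ge0// addr_ge0.
move=> s r hs hr; rewrite /logpoly_sum big_ord_recr /=.
apply: le_trans (ler_normD _ _) _.
rewrite [(C + _) * _]mulrDl [(C * _ + _) * _]mulrDl lerD ?IH//.
rewrite normrM -[leRHS]mulrA mulrACA.
by rewrite ler_pM// ?hC// logpow_bound.
Qed.

(** Lattice differences move along one axis at a time, so derivatives along the axes are recorded,
    as explicit functions to compute with. Joint continuity provides uniformity on boxes. *)
Record slicewise_C2 (R : realType) (F Fs Fss Fr Frr : R -> R -> R) : Prop := {
  slice_s1 : forall s r : R, 0 < s -> 0 < r -> is_derive s 1 (F^~ r) (Fs s r);
  slice_s2 : forall s r : R, 0 < s -> 0 < r -> is_derive s 1 (Fs^~ r) (Fss s r);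
  slice_r1 : forall s r : R, 0 < s -> 0 < r -> is_derive r 1 (F s) (Fr s r);
  slice_r2 : forall s r : R, 0 < s -> 0 < r -> is_derive r 1 (Fr s) (Frr s r);
  slice_cts : forall G, List.In G [:: F; Fs; Fss; Fr; Frr] -> forall z : R * R,
    0 < z.1 -> 0 < z.2 -> {for z, continuous (fun z : R * R => G z.1 z.2)}
}.

(* With [q_0 = r^-l], [q_(j+1)] the Laplacian of [q_j] and [Q = sum_(j <= N) F_j q_j], the left-hand
   side of the last estimate telescopes to [- F_N q_(N+1)]. *)
Lemma epd_solution (R : realType) (al : R) (n l N : nat) :
  al <= 0 -> (0 < N)%N ->
  exists (Q Qs Qss Qr Qrr : R -> R -> R) (C : R),
    [/\ slicewise_C2 Q Qs Qss Qr Qrr, 0 <= C &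
     forall s r : R, 0 < s <= 1 -> 1 <= r ->
     [/\ `|Q s r - s `^ al * r^-1 ^+ l| <= C * s * (s `^ al * r^-1 ^+ l),
        `|Q s r| <= C * s `^ (al - 2) * r^-1 ^+ l,
        `|Qs s r| <= C * s `^ (al - 2) * r^-1 ^+ l,
        `|Qr s r| <= C * s `^ (al - 2) * r^-1 ^+ l &
        `|Qss s r - al * (al - 1) / s ^+ 2 * Q s r
          - (4 * (r - 1) * Qrr s r + (2 * n)%:R * Qr s r)|
        <= C * s `^ (al + 2 * N%:R - 1) * r^-1 ^+ l]].
Proof.
move=> al0; case: N => // N _.
have [A [B [A0 B0 AB]]] := logpow_coefficients al0.
pose b (j : nat) : R := al + 2 * j%:R.
pose p j := iter j (radial_laplacian n) ('X^l : {poly R}).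
have pl j : 'X^l %| p j.
  by elim: j => [|j IH]; [exact: dvdpp|exact: multXn_radial_laplacian].
pose Q := logpoly_sum N.+1 b A B p.
pose b' j := b j - 1. pose A' j := b j * A j. pose B' j := b j * B j + A j.
pose Qs := logpoly_sum N.+1 b' A' B' p.
pose Qss := logpoly_sum N.+1 (fun j => b' j - 1) (fun j => b' j * A' j)
  (fun j => b' j * B' j + A' j) p.
pose Qr := logpoly_sum N.+1 b A B (fun j => dinv (p j)).
pose Qrr := logpoly_sum N.+1 b A B (fun j => dinv (dinv (p j))).
have bal j : al <= b j by rewrite /b lerDl mulr_ge0.
(* Every term after the leading one has exponent at least [al + 2], and one unit is given up to its
   logarithm. *)
have [C1 C10 h1] : exists2 C : R, 0 <= C & forall s r : R, 0 < s <= 1 -> 1 <= r ->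
    `|Q s r - s `^ al * r^-1 ^+ l| <= C * s `^ (al + 1) * r^-1 ^+ l.
  have [|C C0 h] := @logpoly_sum_bound R N (fun j => b j.+1) (fun j => A j.+1)
    (fun j => B j.+1) (fun j => p j.+1) l (al + 1) _ (fun j => pl j.+1).
    by move=> j; rewrite /b -natr1; have : 0 <= j%:R :> R by []; lra.
  exists C => // s r hs hr; rewrite /Q /logpoly_sum big_ord_recl /=.
  have -> : logpow (b 0%N) (A 0%N) (B 0%N) s * invpoly (p 0%N) r = s `^ al * r^-1 ^+ l.
    by rewrite /logpow /invpoly A0 B0 mul0r add0r mulr1 hornerXn /b mulr0 addr0.
  by rewrite addrAC subrr add0r; apply: h.
(* The common exponent [al - 2] is dictated by [Qs]: its exponents start at [al - 1], and one unit
   goes to the logarithm. *)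
have [C2 C20 h2] : exists2 C : R, 0 <= C & forall s r : R, 0 < s <= 1 -> 1 <= r ->
    `|Q s r| <= C * s `^ (al - 2) * r^-1 ^+ l.
  by apply: logpoly_sum_bound => // j; have := bal j; lra.
have [C3 C30 h3] : exists2 C : R, 0 <= C & forall s r : R, 0 < s <= 1 -> 1 <= r ->
    `|Qs s r| <= C * s `^ (al - 2) * r^-1 ^+ l.
  by apply: logpoly_sum_bound => // j; have := bal j; rewrite /b'; lra.
have [C4 C40 h4] : exists2 C : R, 0 <= C & forall s r : R, 0 < s <= 1 -> 1 <= r ->
    `|Qr s r| <= C * s `^ (al - 2) * r^-1 ^+ l.
  apply: logpoly_sum_bound => j; first by have := bal j; lra.
  exact: multXn_dinv.
have [C5 C50 h5] := invpoly_bound (pl N.+2).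
pose C6 := (`|A N.+1| + `|B N.+1|) * C5.
have C60 : 0 <= C6 by rewrite mulr_ge0// addr_ge0.
have eqQ s r : 0 < s -> 0 < r -> Qss s r - al * (al - 1) / s ^+ 2 * Q s r
          - (4 * (r - 1) * Qrr s r + (2 * n)%:R * Qr s r) =
     - (logpow (b N.+1) (A N.+1) (B N.+1) s * invpoly (p N.+2) r).
  move=> s0 r0; have rn0 : r != 0 by rewrite gt_eqF.
  have -> : 4 * (r - 1) * Qrr s r + (2 * n)%:R * Qr s r =
     \sum_(j < N.+2) logpow (b j) (A j) (B j) s * invpoly (p j.+1) r.
    rewrite /Qrr /Qr /logpoly_sum !mulr_sumr -big_split/=; apply: eq_bigr => j _.
    by rewrite invpoly_radial_laplacian//; ring.
  have -> : Qss s r - al * (al - 1) / s ^+ 2 * Q s r =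
     \sum_(j < N.+1) logpow (b j) (A j) (B j) s * invpoly (p j.+1) r.
    rewrite /Qss /Q /logpoly_sum mulr_sumr -sumrB big_ord_recl /=.
    have s2 : s `^ 2 = s ^+ 2 by rewrite -powR_mulrn ?ltW.
    have sn0 : s != 0 by rewrite gt_eqF.
    have pw (x y : R) : s `^ (x + y) = s `^ x * s `^ y.
      by rewrite powRD// [s == 0]gt_eqF// implybT.
    (* The term [j = 0] drops out because [s^al] solves the homogeneous equation; each later term
       reproduces its predecessor in the sum of Laplacians. *)
    rewrite [X in X + _](_ : _ = 0) ?add0r.
      apply: eq_bigr => j _; rewrite /bump add1n.
      rewrite mulrA -mulrBl; congr (_ * _).
      have [e1 e2] := AB j.
      have bE : b j.+1 = b j + 2 by rewrite /b -natr1; ring.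
      have -> : b j = b' j.+1 - 1 by rewrite /b' bE; ring.
      rewrite /logpow [X in _ / _ * (s `^ X * _)](_ : b j.+1 = b' j.+1 - 1 + 2); last first.
        by rewrite /b'; ring.
      rewrite [s `^ (_ + 2)]pw s2 -e1 -e2 /A' /B' /b' -/(b j.+1); field.
      exact: sn0.
    rewrite /logpow /A' /B' /b' A0 B0 /b !(mulr0, addr0, mul0r, add0r, mulr1).
    rewrite (_ : al - 1 - 1 = al - 2); last by ring.
    have -> : s `^ al = s `^ (al - 2) * s ^+ 2 by rewrite -s2 -pw subrK.
    by field.
  by rewrite (big_ord_recr N.+1)/=; ring.
exists Q, Qs, Qss, Qr, Qrr, (C1 + C2 + C3 + C4 + C6); split.
- split.
  + by move=> s r s0 r0; exact: is_derive_logpoly_sum_l.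
  + by move=> s r s0 r0; exact: is_derive_logpoly_sum_l.
  + by move=> s r s0 r0; apply: is_derive_logpoly_sum_r; rewrite gt_eqF.
  + by move=> s r s0 r0; apply: is_derive_logpoly_sum_r; rewrite gt_eqF.
  + move=> G /= hG z z1 z2; have z2' : z.2 != 0 by rewrite gt_eqF.
    by case: hG => [<-|[<-|[<-|[<-|[<-|//]]]]]; exact: logpoly_sum_continuous.
- by rewrite !addr_ge0.
- move=> s r hs hr; have /andP[s0 s1] := hs; have r0 : 0 < r by lra.
  have rl : 0 <= r^-1 ^+ l by rewrite exprn_ge0// invr_ge0 ltW.
  have mon (D e : R) : 0 <= D -> D <= C1 + C2 + C3 + C4 + C6 ->
      D * s `^ e * r^-1 ^+ l <= (C1 + C2 + C3 + C4 + C6) * s `^ e * r^-1 ^+ l.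
    by move=> D0 DC; rewrite ler_wpM2r// ler_wpM2r// powR_ge0.
  split.
  + rewrite mulrA -[_ * s * _]mulrA.
    have -> : s * s `^ al = s `^ (al + 1).
      by rewrite powRD ?powRr1 ?(ltW s0) ?[s == 0]gt_eqF// ?implybT// mulrC.
    by apply: le_trans (h1 _ _ hs hr) _; apply: mon; lra.
  + by apply: le_trans (h2 _ _ hs hr) _; apply: mon; lra.
  + by apply: le_trans (h3 _ _ hs hr) _; apply: mon; lra.
  + by apply: le_trans (h4 _ _ hs hr) _; apply: mon; lra.
  + rewrite eqQ// normrN; apply: (@le_trans _ _ (C6 * s `^ (al + 2 * N.+1%:R - 1) * r^-1 ^+ l)).
      rewrite normrM /C6 -[leRHS]mulrA mulrACA ler_pM// ?h5//.
      by apply: logpow_bound => //; rewrite /b; lra.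
    by apply: mon; lra.
Qed.

(* [cutoff K q m (s * r)] vanishes for [1 <= K s r] and differs from 1 by [O((s r)^q)], so its
   derivatives are negligible at early times, i.e. for small [s]. *)
Definition cutoff (R : realType) (K : R) (q m : nat) (y : R) : R :=
  Num.max (1 - (K * y) ^+ q.+2) 0 ^+ m.+3.

Definition cutoff' (R : realType) (K : R) (q m : nat) (y : R) : R :=
  m.+3%:R * Num.max (1 - (K * y) ^+ q.+2) 0 ^+ m.+2 * - (q.+2%:R * K * (K * y) ^+ q.+1).

Definition cutoff'' (R : realType) (K : R) (q m : nat) (y : R) : R :=
  m.+3%:R * m.+2%:R * Num.max (1 - (K * y) ^+ q.+2) 0 ^+ m.+1
    * (q.+2%:R * K * (K * y) ^+ q.+1) ^+ 2
  - m.+3%:R * Num.max (1 - (K * y) ^+ q.+2) 0 ^+ m.+2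
    * (q.+2%:R * q.+1%:R * K ^+ 2 * (K * y) ^+ q).

Lemma is_derive_scaled_exp (R : realType) (K : R) (q : nat) (y : R) :
  is_derive y 1 (fun y : R => (K * y) ^+ q.+1) (q.+1%:R * K * (K * y) ^+ q).
Proof.
have d1 : is_derive y 1 (fun y : R => K * y) K.
  by apply: trigger_derive; rewrite /GRing.scale/=; ring.
have d2 : is_derive (K * y) 1 (fun z : R => z ^+ q.+1) (q.+1%:R * (K * y) ^+ q).
  split; first exact: exprn_derivable.
  by rewrite exp_derive /GRing.scale/= mulr1.
apply: (trigger_derive (is_derive1_comp d2 d1)); ring.
Qed.

Lemma is_derive_cutoff_pospart (R : realType) (K : R) (q m : nat) (y : R) :
  is_derive y 1 (fun y : R => Num.max (1 - (K * y) ^+ q.+2) 0 ^+ m.+2)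
    (m.+2%:R * Num.max (1 - (K * y) ^+ q.+2) 0 ^+ m.+1 * - (q.+2%:R * K * (K * y) ^+ q.+1)).
Proof.
have d1 : is_derive y 1 (fun y : R => 1 - (K * y) ^+ q.+2) (- (q.+2%:R * K * (K * y) ^+ q.+1)).
  have d := is_derive_scaled_exp K q.+1 y.
  by apply: (trigger_derive (is_deriveB (is_derive_cst (1:R) y 1) d)); rewrite sub0r.
exact: (is_derive1_comp (is_derive_pospart_exp m _) d1).
Qed.

Lemma is_derive_cutoff (R : realType) (K : R) (q m : nat) (y : R) :
  is_derive y 1 (cutoff K q m) (cutoff' K q m y).
Proof. exact: is_derive_cutoff_pospart. Qed.

Lemma is_derive_cutoff' (R : realType) (K : R) (q m : nat) (y : R) :
  is_derive y 1 (cutoff' K q m) (cutoff'' K q m y).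
Proof.
have d1 := is_derive_cutoff_pospart K q m y.
have d2 := is_derive_scaled_exp K q y.
rewrite /cutoff'; apply: trigger_derive.
by rewrite /cutoff'' /GRing.scale/=; ring.
Qed.

Lemma cutoff''_continuous (R : realType) (K : R) (q m : nat) : continuous (cutoff'' K q m).
Proof.
have cK i : continuous (fun y : R => (K * y) ^+ i).
  move=> y; case: i => [|i]; first by under eq_fun do rewrite expr0; exact: cvg_cst.
  exact: (is_derive_continuous (is_derive_scaled_exp K i y)).
have cP i : continuous (fun y : R => Num.max (1 - (K * y) ^+ q.+2) 0 ^+ i).
  move=> y; apply: (@continuous_comp _ _ _ (fun y : R => Num.max (1 - (K * y) ^+ q.+2) 0)
    (fun z : R => z ^+ i)); last exact: exprn_continuous.
  apply: (@continuous_max _ _ (fun y : R => 1 - (K * y) ^+ q.+2) (cst 0)); last exact: cvg_cst.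
  by apply: cvgB; [exact: cvg_cst|exact: cK].
move=> y; apply: cvgB.
  apply: cvgM.
    by apply: cvgM; [exact: cvg_cst|exact: cP].
  apply: (@continuous_comp _ _ _ (fun y : R => q.+2%:R * K * (K * y) ^+ q.+1)
    (fun z : R => z ^+ 2)); last exact: exprn_continuous.
  by apply: cvgM; [exact: cvg_cst|exact: cK].
apply: cvgM.
  by apply: cvgM; [exact: cvg_cst|exact: cP].
by apply: cvgM; [exact: cvg_cst|exact: cK].
Qed.

(** Excess factors [K y] and [e] are at most 1 and are discarded. The power of [e] is kept in the
    bounds, because they are divided later by a function of size [e^(m + 3)]; the power [y^q] is the
    smallness at early times. *)
Lemma cutoff_bounds (R : realType) (K : R) (q m : nat) : 0 < K ->
  exists2 C : R, 0 <= C & forall y, 0 <= y -> K * y < 1 ->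
    let e := 1 - (K * y) ^+ q.+2 in
    [/\ 0 < e <= 1, cutoff K q m y = e ^+ m.+3,
     `|cutoff' K q m y| <= C * e ^+ m.+1 * y ^+ q &
     `|cutoff'' K q m y| <= C * e ^+ m.+1 * y ^+ q].
Proof.
move=> K0.
have Kge0 := ltW K0.
pose C1 : R := m.+3%:R * (q.+2%:R * K) * K ^+ q.
pose D1 : R := m.+3%:R * m.+2%:R * (q.+2%:R * K) ^+ 2 * K ^+ q.
pose D2 : R := m.+3%:R * (q.+2%:R * q.+1%:R * K ^+ 2) * K ^+ q.
pose C2 := D1 + D2.
have Kq : 0 <= K ^+ q by rewrite exprn_ge0 // ltW.
have qK : 0 <= q.+2%:R * K by rewrite mulr_ge0// ltW.
have C10 : 0 <= C1 by rewrite /C1 !mulr_ge0// ltW.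
have C20 : 0 <= C2 by rewrite /C2 addr_ge0// !mulr_ge0 ?exprn_ge0// ltW.
exists (C1 + C2); first exact: addr_ge0.
move=> y y0 Ky e.
have Ky0 : 0 <= K * y by rewrite mulr_ge0// ltW.
have w0 i : 0 <= (K * y) ^+ i by rewrite exprn_ge0.
have w1 i : (K * y) ^+ i <= 1 by rewrite exprn_ile1// ltW.
have e0 : 0 < e by rewrite subr_gt0 exprn_ilt1.
have e1 : e <= 1 by rewrite /e lerBlDr lerDl.
have maxE : Num.max (1 - (K * y) ^+ q.+2) 0 = e by rewrite max_l// ltW.
have em : 0 <= e ^+ m.+1 by rewrite exprn_ge0// ltW.
have em2 : e ^+ m.+2 <= e ^+ m.+1 by rewrite exprS ler_piMl.
have em20 : 0 <= e ^+ m.+2 by rewrite exprn_ge0// ltW.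
have yq : 0 <= y ^+ q by rewrite exprn_ge0.
have KyqE : (K * y) ^+ q = K ^+ q * y ^+ q by rewrite exprMn.
have w2 : (K * y) ^+ q.+1 <= K ^+ q * y ^+ q by rewrite -KyqE exprS ler_piMl// ltW.
have key (a b c : R) : 0 <= a -> 0 <= b -> b <= e ^+ m.+1 -> 0 <= c -> c <= K ^+ q * y ^+ q ->
    a * b * c <= a * K ^+ q * e ^+ m.+1 * y ^+ q.
  move=> a0 b0 be c0 cq.
  have -> : a * K ^+ q * e ^+ m.+1 * y ^+ q = a * e ^+ m.+1 * (K ^+ q * y ^+ q) by ring.
  by rewrite ler_pM ?mulr_ge0// ler_wpM2l.
split => //; first by rewrite e0.
- by rewrite /cutoff maxE.
- rewrite /cutoff' maxE mulrN normrN ger0_norm; last by rewrite !mulr_ge0// ltW.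
  apply: (@le_trans _ _ (C1 * e ^+ m.+1 * y ^+ q)); last first.
    by rewrite ler_wpM2r// ler_wpM2r// lerDl.
  have -> : m.+3%:R * e ^+ m.+2 * (q.+2%:R * K * (K * y) ^+ q.+1) =
    (m.+3%:R * (q.+2%:R * K)) * e ^+ m.+2 * (K * y) ^+ q.+1 by ring.
  by apply: key => //; rewrite mulr_ge0.
- rewrite /cutoff'' maxE.
  apply: (@le_trans _ _ (C2 * e ^+ m.+1 * y ^+ q)); last first.
    by rewrite ler_wpM2r// ler_wpM2r// lerDr.
  apply: le_trans (ler_normB _ _) _; rewrite /C2 (mulrDl D1 D2) (mulrDl (D1 * _)) lerD//.
    rewrite ger0_norm; last by rewrite mulr_ge0 ?exprn_ge0 ?mulr_ge0.
    have -> : m.+3%:R * m.+2%:R * e ^+ m.+1 * (q.+2%:R * K * (K * y) ^+ q.+1) ^+ 2 =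
      (m.+3%:R * m.+2%:R * (q.+2%:R * K) ^+ 2) * e ^+ m.+1 * ((K * y) ^+ q.+1) ^+ 2 by ring.
    apply: key => //; [by rewrite !mulr_ge0|by rewrite exprn_ge0|].
    by apply: le_trans w2; rewrite expr2 ler_piMl.
  have K2 : 0 <= q.+2%:R * q.+1%:R * K ^+ 2 by rewrite !mulr_ge0// exprn_ge0// ltW.
  rewrite ger0_norm; last by rewrite !mulr_ge0// ltW.
  have -> : m.+3%:R * e ^+ m.+2 * (q.+2%:R * q.+1%:R * K ^+ 2 * (K * y) ^+ q) =
    (m.+3%:R * (q.+2%:R * q.+1%:R * K ^+ 2)) * e ^+ m.+2 * (K * y) ^+ q by ring.
  apply: key => //; first by rewrite mulr_ge0.
  by rewrite KyqE.
Qed.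

Lemma slicewise_C2_cutoff (R : realType) (K : R) (q m : nat) (Q Qs Qss Qr Qrr : R -> R -> R) :
  slicewise_C2 Q Qs Qss Qr Qrr ->
  let Z (s r : R) := cutoff K q m (s * r) in
  let Z1 (s r : R) := cutoff' K q m (s * r) in
  let Z2 (s r : R) := cutoff'' K q m (s * r) in
  slicewise_C2 (fun s r => Z s r * Q s r)
    (fun s r => r * Z1 s r * Q s r + Z s r * Qs s r)
    (fun s r => r ^+ 2 * Z2 s r * Q s r + 2 * r * Z1 s r * Qs s r + Z s r * Qss s r)
    (fun s r => s * Z1 s r * Q s r + Z s r * Qr s r)
    (fun s r => s ^+ 2 * Z2 s r * Q s r + 2 * s * Z1 s r * Qr s r + Z s r * Qrr s r).
Proof.
case=> ds1 ds2 dr1 dr2 ctQ Z Z1 Z2.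
have dl (s r : R) : is_derive s 1 (fun s : R => s * r) r.
  by apply: trigger_derive; rewrite /GRing.scale/=; ring.
have dr (s r : R) : is_derive r 1 (fun r : R => s * r) s.
  by apply: trigger_derive; rewrite /GRing.scale/=; ring.
have dZs (s r : R) : is_derive s 1 (Z^~ r) (Z1 s r * r).
  exact: (@is_derive1_comp R (cutoff K q m) ( *%R^~ r) s _ _ (is_derive_cutoff K q m (s * r)) (dl s r)).
have dZ1s (s r : R) : is_derive s 1 (Z1^~ r) (Z2 s r * r).
  exact: (@is_derive1_comp R (cutoff' K q m) ( *%R^~ r) s _ _ (is_derive_cutoff' K q m (s * r)) (dl s r)).
have dZr (s r : R) : is_derive r 1 (Z s) (Z1 s r * s).
  exact: (@is_derive1_comp R (cutoff K q m) ( *%R s) r _ _ (is_derive_cutoff K q m (s * r)) (dr s r)).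
have dZ1r (s r : R) : is_derive r 1 (Z1 s) (Z2 s r * s).
  exact: (@is_derive1_comp R (cutoff' K q m) ( *%R s) r _ _ (is_derive_cutoff' K q m (s * r)) (dr s r)).
split.
- move=> s r s0 r0; have d1 := dZs s r; have d2 := ds1 _ _ s0 r0.
  by apply: (trigger_derive (is_deriveM d1 d2)); rewrite /GRing.scale/=; ring.
- move=> s r s0 r0; have d1 := dZs s r; have d2 := ds1 _ _ s0 r0.
  have d3 := dZ1s s r; have d4 := ds2 _ _ s0 r0.
  have d5 := is_deriveM (is_deriveM (is_derive_cst r s 1) d3) d2.
  by apply: (trigger_derive (is_deriveD d5 (is_deriveM d1 d4))); rewrite /GRing.scale/= ?fctE /cst /=; ring.
- move=> s r s0 r0; have d1 := dZr s r; have d2 := dr1 _ _ s0 r0.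
  by apply: (trigger_derive (is_deriveM d1 d2)); rewrite /GRing.scale/=; ring.
- move=> s r s0 r0; have d1 := dZr s r; have d2 := dr1 _ _ s0 r0.
  have d3 := dZ1r s r; have d4 := dr2 _ _ s0 r0.
  have d5 := is_deriveM (is_deriveM (is_derive_cst s r 1) d3) d2.
  by apply: (trigger_derive (is_deriveD d5 (is_deriveM d1 d4))); rewrite /GRing.scale/= ?fctE /cst /=; ring.
- move=> G hG z z1 z2.
  have c0 : {for z, continuous (fun z : R * R => Q z.1 z.2)} by apply: ctQ => //; rewrite /=; tauto.
  have c1 : {for z, continuous (fun z : R * R => Qs z.1 z.2)} by apply: ctQ => //; rewrite /=; tauto.
  have c2 : {for z, continuous (fun z : R * R => Qss z.1 z.2)} by apply: ctQ => //; rewrite /=; tauto.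
  have c3 : {for z, continuous (fun z : R * R => Qr z.1 z.2)} by apply: ctQ => //; rewrite /=; tauto.
  have c4 : {for z, continuous (fun z : R * R => Qrr z.1 z.2)} by apply: ctQ => //; rewrite /=; tauto.
  have cf : {for z, continuous (fun z : R * R => z.1)} by exact: cvg_fst.
  have cs : {for z, continuous (fun z : R * R => z.2)} by exact: cvg_snd.
  have cc (x : R) : {for z, continuous (fun z : R * R => x)} by exact: cvg_cst.
  have cm : {for z, continuous (fun z : R * R => z.1 * z.2)} by exact: cvgM.
  have cZ : {for z, continuous (fun z : R * R => Z z.1 z.2)}.
    exact: (@continuous_comp _ _ _ _ (cutoff K q m) _ cm
      (is_derive_continuous (is_derive_cutoff K q m _))).
  have cZ1 : {for z, continuous (fun z : R * R => Z1 z.1 z.2)}.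
    exact: (@continuous_comp _ _ _ _ (cutoff' K q m) _ cm
      (is_derive_continuous (is_derive_cutoff' K q m _))).
  have cZ2 : {for z, continuous (fun z : R * R => Z2 z.1 z.2)}.
    exact: (@continuous_comp _ _ _ _ (cutoff'' K q m) _ cm (@cutoff''_continuous R K q m _)).
  have cM (f g : R * R -> R) : {for z, continuous f} -> {for z, continuous g} ->
     {for z, continuous (fun z => f z * g z)} by move=> ? ?; exact: cvgM.
  have cD (f g : R * R -> R) : {for z, continuous f} -> {for z, continuous g} ->
     {for z, continuous (fun z => f z + g z)} by move=> ? ?; exact: cvgD.
  have cX (f : R * R -> R) : {for z, continuous f} -> {for z, continuous (fun z => f z ^+ 2)}.
    by move=> cf'; exact: (cM f f).
  case: hG => [<-|[<-|[<-|[<-|[<-|//]]]]] /=.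
  - exact: (cM).
  - by apply: (cD); apply: (cM) => //; apply: (cM).
  - apply: (cD); last exact: (cM).
    apply: (cD); (apply: (cM) => //; apply: (cM) => //); first exact: (cX).
    by apply: (cM) => //; exact: (cc).
  - by apply: (cD); apply: (cM) => //; apply: (cM).
  - apply: (cD); last exact: (cM).
    apply: (cD); (apply: (cM) => //; apply: (cM) => //); first exact: (cX).
    by apply: (cM) => //; exact: (cc).
Qed.

(** The Euler-Poisson-Darboux type operator [d_s^2 - Laplacian + c / s^2] with [c = - al (al - 1)],
    on functions of [s] and [r = 1 + |x|^2]. *)
Definition epd_operator (R : realType) (al : R) (n : nat) (F Fss Fr Frr : R -> R -> R) (s r : R) : R :=
  Fss s r - al * (al - 1) / s ^+ 2 * F s r - (4 * (r - 1) * Frr s r + (2 * n)%:R * Fr s r).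

Lemma powRDp (R : realType) (x a b : R) : 0 < x -> x `^ (a + b) = x `^ a * x `^ b.
Proof. by move=> x0; rewrite powRD// [x == 0]gt_eqF// implybT. Qed.

Lemma exprV_powR (R : realType) (x : R) (l : nat) : 0 < x -> x^-1 ^+ l = x `^ (- l%:R).
Proof. by move=> x0; rewrite powR_invn ?exprVn// ltW. Qed.

(** With [ka = 1 / (p - 1)], the quantity in the last clause is the remainder in Young's inequality.
    The factor [s^a] will compensate the time weight of the nonlinearity, and [r^-n] makes the
    remainder summable over space, uniformly in the size of the box. *)
Lemma test_function (R : realType) (al ka a : R) (n : nat) : al <= 0 -> 0 < ka ->
  exists (F Fs Fss Fr Frr : R -> R -> R) (K C c : R),
    [/\ slicewise_C2 F Fs Fss Fr Frr, 4 <= K, 0 < C, 0 < c &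
    [/\ forall s r : R, 0 < s -> 1 <= r -> 0 <= F s r,
        forall s r : R, 1 <= K * (s * r) -> F s r = 0,
        forall s r : R, 0 < s -> 1 <= r <= 2 -> K * s <= 4^-1 -> c <= F s r &
        forall s r : R, 0 < s -> 1 <= r ->
          let E := epd_operator al n F Fss Fr Frr s r in
          (F s r = 0 /\ E = 0) \/
          (0 < F s r /\ `|E| * (`|E| / F s r) `^ ka <= C * s `^ a * r^-1 ^+ n)]].
Proof.
move=> al0 ka0.
have nat_above (x : R) : exists k : nat, x <= k%:R.
  by exists (Num.truncn x).+1; apply: ltW; exact: truncnS_gt.
(* [q0] produces the factor [s^a] out of [s^(al + q0)], and [q = q0 + 2] makes up for the exponent
   [al - 2] of the bounds on [Q]. [m] absorbs the loss [e^(- 2 ka)] at the edge of the support, and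
   [l] absorbs the growth [r^((q + 2) (1 + ka))] and leaves [r^-n]. *)
have [q0 hq0] := nat_above (a - al).
pose q := q0.+2.
have [m hm] := nat_above (2 * ka).
have [l hl] := nat_above (n%:R + (q.+2)%:R * (1 + ka)).
have [Q [Qs [Qss [Qr [Qrr [C1 [dQ C10 hQ]]]]]]] := @epd_solution R al n l q.+1 al0 isT.
(* On the support [K s < 1], so the summand [2 C1] makes [Q] at least half of its leading term
   there. The summand 4 makes the test function vanish for [s >= 1 / 4]. *)
pose K : R := 4 + 2 * C1.
have K1 : 4 <= K by rewrite /K; lra.
have K1' : 1 <= K by lra.
have K0 : 0 < K by lra.
have [C2 C20 hZ] := @cutoff_bounds R K q m K0.
pose n2 : R := (2 * n)%:R.
have n20 : 0 <= n2 by [].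
pose C3 : R := 1 + C2 * C1 * 20 + C1 + 2 * n2 * C2 * C1.
have C30 : 0 < C3 by rewrite /C3; have := mulr_ge0 C20 C10; nra.
pose Z (s r : R) := cutoff K q m (s * r).
pose Z1 (s r : R) := cutoff' K q m (s * r).
pose Z2 (s r : R) := cutoff'' K q m (s * r).
pose F s r := Z s r * Q s r.
pose Fs s r := r * Z1 s r * Q s r + Z s r * Qs s r.
pose Fss s r := r ^+ 2 * Z2 s r * Q s r + 2 * r * Z1 s r * Qs s r + Z s r * Qss s r.
pose Fr s r := s * Z1 s r * Q s r + Z s r * Qr s r.
pose Frr s r := s ^+ 2 * Z2 s r * Q s r + 2 * s * Z1 s r * Qr s r + Z s r * Qrr s r.
have dF : slicewise_C2 F Fs Fss Fr Frr := slicewise_C2_cutoff K q m dQ.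
(* The first constant combines [|E| <= C3 ...] with [|E| / F <= 2 C3 ...] raised to the power [ka].
   In the lower bound, [K s r <= 1 / 2] gives [e >= 1 / 2]; the other factors come from [Q] being at
   least half of [s^al r^-l], from [s^al >= 1] and from [r <= 2]. *)
exists F, Fs, Fss, Fr, Frr, K, (C3 * (2 * C3) `^ ka), (2^-1 ^+ m.+3 * (2^-1 * 2^-1 ^+ l)).
have zero s r : 1 <= K * (s * r) -> F s r = 0.
  move=> h; rewrite /F /Z /cutoff max_r ?expr0n ?mul0r//.
  by rewrite subr_le0 exprn_ege1.
have inside s r : 0 < s -> 1 <= r -> K * (s * r) < 1 ->
   let e := 1 - (K * (s * r)) ^+ q.+2 in
   [/\ 0 < s <= 1, 0 < e <= 1 & e ^+ m.+3 * (2^-1 * (s `^ al * r^-1 ^+ l)) <= F s r].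
  move=> s0 r1 h e.
  have sr0 : 0 <= s * r by rewrite mulr_ge0//; lra.
  have [he ZE _ _] := hZ _ sr0 h.
  have sKs : K * s <= K * (s * r) by rewrite ler_pM2l// ler_peMr// ltW.
  have Ks1 : K * s < 1 by exact: le_lt_trans sKs h.
  have s1 : s <= 1 by apply: le_trans (ltW Ks1); rewrite ler_peMl// ltW.
  have hs : 0 < s <= 1 by rewrite s0.
  split => //.
  have e0 : 0 <= e by case/andP: he => /ltW.
  rewrite /F /Z ZE ler_wpM2l ?exprn_ge0//.
  have [h1 _ _ _ _] := hQ s r hs r1.
  have Y0 : 0 <= s `^ al * r^-1 ^+ l.
    by rewrite mulr_ge0 ?powR_ge0// exprn_ge0// invr_ge0; lra.
  set Y := s `^ al * _ in h1 Y0 *.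
  have cs : C1 * s <= 2^-1.
    have : K * s < 1 by exact: le_lt_trans sKs h.
    by rewrite /K mulrDl -mulrA; clear -s0; lra.
  have : C1 * s * Y <= 2^-1 * Y by rewrite ler_wpM2r.
  by move: h1; rewrite ler_norml => /andP[]; lra.
split => //.
- by rewrite mulr_gt0// powR_gt0// mulr_gt0.
split => //.
- move=> s r s0 r1.
  have [h|h] := lerP 1 (K * (s * r)); first by rewrite zero.
  have [hs /andP[e0 _]] := inside s r s0 r1 h; apply: le_trans.
  have ri : 0 <= r by lra.
  by rewrite mulr_ge0 ?exprn_ge0 ?(ltW e0)// !mulr_ge0 ?powR_ge0 ?exprn_ge0 ?invr_ge0//.
- move=> s r s0 /andP[r1 r2] Ks.
  have h : K * (s * r) <= 2^-1 by rewrite mulrA; nra.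
  have h1 : K * (s * r) < 1 by lra.
  have [hs he] := inside s r s0 r1 h1; apply: le_trans.
  have r0 : 0 < r by lra.
  have e2 : 2^-1 <= 1 - (K * (s * r)) ^+ q.+2.
    have Ksr0 : 0 <= K * (s * r) by rewrite !mulr_ge0// ltW.
    have : (K * (s * r)) ^+ q.+2 <= K * (s * r).
      by rewrite exprS ler_piMr// exprn_ile1// ltW.
    lra.
  apply: ler_pM.
  + by rewrite exprn_ge0// invr_ge0.
  + by rewrite mulr_ge0// exprn_ge0// invr_ge0.
  + by rewrite lerXn2r// ?nnegrE; lra.
  rewrite ler_wpM2l// -[leLHS]mul1r ler_pM ?exprn_ge0//.
    by rewrite -[leLHS](powRr0 s) ger_powR// .
  have ri : 2^-1 <= r^-1 by rewrite lef_pV2 ?posrE.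
  by rewrite lerXn2r ?nnegrE ?invr_ge0// ltW.
- move=> s r s0 r1 /=; have r0 : 0 < r by lra.
  have sr0 : 0 <= s * r by rewrite mulr_ge0// ltW.
  have [h|h] := lerP 1 (K * (s * r)).
    left; split; first exact: zero.
    have mx : Num.max (1 - (K * (s * r)) ^+ q.+2) 0 = 0.
      by rewrite max_r// subr_le0 exprn_ege1.
    rewrite /epd_operator /F /Fss /Fr /Frr /Z /Z1 /Z2 /cutoff /cutoff' /cutoff'' mx !expr0n/=.
    by ring.
  right.
  have [hs he FY] := inside s r s0 r1 h.
  have [_ ZE Z1b Z2b] := hZ _ sr0 h.
  have [_ Qb Qsb Qrb Eb] := hQ s r hs r1.
  set e := 1 - _ in he FY ZE Z1b Z2b.
  have [s1 e0 e1] : [/\ s <= 1, 0 < e & e <= 1].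
    by case/andP: hs => _ ->; case/andP: he.
  pose L := r^-1 ^+ l; pose w := (s * r) ^+ q.
  have L0 : 0 < L by rewrite exprn_gt0// invr_gt0.
  have w0 : 0 < w by rewrite exprn_gt0// mulr_gt0.
  have S0 x : 0 < s `^ x by exact: powR_gt0.
  have em0 i : 0 < e ^+ i by rewrite exprn_gt0.
  (* The common size, up to [e^(m + 1)], of all terms of [E]: the bound [s^(al - 2) r^-l] on [Q] and
     its derivatives, times [(s r)^q] from the cutoff, times at most [r^2] from the coefficients. *)
  pose T := s `^ (al + q0%:R) * r `^ (q.+2%:R - l%:R).
  have T0 : 0 < T by rewrite mulr_gt0// powR_gt0.
  have TE : s `^ (al - 2) * w * r ^+ 2 * L = T.
    rewrite /w /L exprMn exprV_powR// -!powR_mulrn ?(ltW s0) ?(ltW r0)//.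
    rewrite /T.
    have -> : s `^ (al - 2) * (s `^ q%:R * r `^ q%:R) * r `^ 2 * r `^ (- l%:R) =
      (s `^ (al - 2) * s `^ q%:R) * ((r `^ q%:R * r `^ 2) * r `^ (- l%:R)) by ring.
    rewrite -!powRDp//; congr (_ `^ _ * _ `^ _).
      by rewrite /q -addn2 natrD; ring.
    by rewrite -[q.+2]addn2 natrD.
  have E_le : `|epd_operator al n F Fss Fr Frr s r| <= C3 * e ^+ m.+1 * T.
    (* Only the first term is free of derivatives of the cutoff; it is small because [Q] nearly
       solves the equation. All the others carry the factor [(s r)^q]. *)
    have -> : epd_operator al n F Fss Fr Frr s r =
      Z s r * (Qss s r - al * (al - 1) / s ^+ 2 * Q s r
          - (4 * (r - 1) * Qrr s r + n2 * Qr s r))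
      + (r ^+ 2 - 4 * (r - 1) * s ^+ 2) * (Z2 s r * Q s r)
      + 2 * r * (Z1 s r * Qs s r) - 8 * (r - 1) * s * (Z1 s r * Qr s r)
      - n2 * s * (Z1 s r * Q s r).
      by rewrite /epd_operator /F /Fss /Fr /Frr -/n2; ring.
    pose W := C2 * C1 * (e ^+ m.+1 * (w * s `^ (al - 2) * L)).
    have W0 : 0 <= W := mulr_ge0 (mulr_ge0 C20 C10)
      (mulr_ge0 (ltW (em0 _)) (mulr_ge0 (mulr_ge0 (ltW w0) (powR_ge0 _ _)) (ltW L0))).
    have prod (x y : R) : `|x| <= C2 * e ^+ m.+1 * w -> `|y| <= C1 * s `^ (al - 2) * L ->
        `|x * y| <= W.
      move=> hx hy; rewrite normrM.
      have -> : W = (C2 * e ^+ m.+1 * w) * (C1 * s `^ (al - 2) * L) by rewrite /W; ring.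
      exact: ler_pM.
    have b1 := prod _ _ Z2b Qb. have b2 := prod _ _ Z1b Qsb.
    have b3 := prod _ _ Z1b Qrb. have b4 := prod _ _ Z1b Qb.
    have r21 : 1 <= r ^+ 2 by rewrite exprn_ege1.
    have rr2 : r <= r ^+ 2 by rewrite expr2 ler_peMl// ltW.
    have b0 : `|Z s r * (Qss s r - al * (al - 1) / s ^+ 2 * Q s r
          - (4 * (r - 1) * Qrr s r + n2 * Qr s r))| <= C1 * e ^+ m.+1 * T.
      rewrite normrM /Z ZE (ger0_norm (ltW (em0 _))).
      have -> : C1 * e ^+ m.+1 * T = e ^+ m.+1 * (C1 * T) by ring.
      apply: ler_pM => //; first exact: ltW.
        have -> : e ^+ m.+3 = e ^+ 2 * e ^+ m.+1 by rewrite -exprD.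
        by apply: ler_piMl; [exact: ltW|rewrite exprn_ile1// ltW].
      apply: le_trans Eb _; rewrite -mulrA ler_wpM2l// -TE.
      rewrite ler_wpM2r ?(ltW L0)//.
      rewrite -[leLHS]mulr1 ler_pM// ?powR_ge0//.
      rewrite /w exprMn -powR_mulrn ?(ltW s0)// mulrA -powRDp//.
      rewrite -[leLHS]mulr1 ler_pM// ?powR_ge0// ?exprn_ege1//.
      apply: ger_powR; first by rewrite s0.
      by rewrite -natr1; have : 0 <= q%:R :> R by []; clear; lra.
    have s20 : 0 <= s ^+ 2 by rewrite exprn_ge0// ltW.
    have s21 : s ^+ 2 <= 1 by rewrite exprn_ile1// ltW.
    have norm_le (c c' x : R) : `|c| <= c' * r ^+ 2 -> `|x| <= W -> `|c * x| <= c' * (r ^+ 2 * W).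
      by move=> hc hx; rewrite normrM mulrA ler_pM.
    have rs : 0 <= (r - 1) * s ^+ 2 <= r ^+ 2.
      rewrite mulr_ge0 ?subr_ge0//= -[leRHS]mulr1 ler_pM// ?subr_ge0//; clear -rr2; lra.
    have rs1 : 0 <= (r - 1) * s <= r ^+ 2.
      rewrite mulr_ge0 ?subr_ge0 ?(ltW s0)//= -[leRHS]mulr1 ler_pM// ?subr_ge0 ?(ltW s0)//; clear -rr2; lra.
    have k1 : `|(r ^+ 2 - 4 * (r - 1) * s ^+ 2) * (Z2 s r * Q s r)| <= 5 * (r ^+ 2 * W).
      by apply: norm_le => //; rewrite ler_norml; clear -rs rs1 rr2 r1 r21; lra.
    have k2 : `|2 * r * (Z1 s r * Qs s r)| <= 2 * (r ^+ 2 * W).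
      by apply: norm_le => //; rewrite ler_norml; clear -rs rs1 rr2 r1 r21; lra.
    have k3 : `|8 * (r - 1) * s * (Z1 s r * Qr s r)| <= 8 * (r ^+ 2 * W).
      by apply: norm_le => //; rewrite ler_norml; clear -rs rs1 rr2 r1 r21; lra.
    have k4 : `|n2 * s * (Z1 s r * Q s r)| <= n2 * (r ^+ 2 * W).
      apply: norm_le => //; rewrite normrM (ger0_norm n20) (gtr0_norm s0) ler_wpM2l//.
      exact: le_trans r21.
    have WE : r ^+ 2 * W = C2 * C1 * (e ^+ m.+1 * T) by rewrite /W -TE; ring.
    rewrite WE in k1 k2 k3 k4.
    have CC : 0 <= C2 * C1 by exact: mulr_ge0.
    have eT : 0 <= e ^+ m.+1 * T by rewrite ltW// mulr_gt0.
    have -> : C3 * e ^+ m.+1 * T = e ^+ m.+1 * T + C1 * e ^+ m.+1 * T +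
       20 * (C2 * C1 * (e ^+ m.+1 * T)) + 2 * (n2 * (C2 * C1 * (e ^+ m.+1 * T))).
      by rewrite /C3; ring.
    have p1 : 0 <= C2 * C1 * (e ^+ m.+1 * T) by exact: mulr_ge0.
    have p2 : 0 <= n2 * (C2 * C1 * (e ^+ m.+1 * T)) by exact: mulr_ge0.
    move: b0 k1 k2 k3 k4 eT p1 p2; clear; rewrite !ler_norml => /andP[? ?] /andP[? ?] /andP[? ?] /andP[? ?] /andP[? ?] ? ? ?.
    by apply/andP; split; lra.
  (* [2 C3 G] is the quotient of the upper bound for [|E|] by the lower bound for [F]: dividing
     loses [e^-2] and [r^(q + 2)], while a gain [s^q0] remains. *)
  pose G := e `^ (-2) * (s `^ q0%:R * r `^ q.+2%:R).
  have G0 : 0 < G by rewrite !mulr_gt0// powR_gt0.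
  have F0 : 0 < F s r.
    apply: lt_le_trans FY; apply: mulr_gt0 => //.
    by apply: mulr_gt0; [rewrite invr_gt0|exact: (mulr_gt0 (S0 _) L0)].
  split => //.
  have EF : `|epd_operator al n F Fss Fr Frr s r| / F s r <= 2 * C3 * G.
    rewrite ler_pdivrMr//; apply: le_trans E_le _.
    have CG : 0 <= 2 * C3 * G := mulr_ge0 (mulr_ge0 (ler0n _ 2) (ltW C30)) (ltW G0).
    apply: le_trans (ler_wpM2l CG FY).
    rewrite -[e ^+ m.+3]/(e ^+ (2 + m.+1)) exprD /G powRN (powR_mulrn 2 (ltW e0)).
    rewrite /T powRDp// -/L.
    have -> : r `^ (q.+2%:R - l%:R) = r `^ q.+2%:R * L by rewrite powRDp// /L exprV_powR.
    rewrite le_eqVlt; apply/orP; left; apply/eqP; field.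
    by rewrite gt_eqF.
  apply: (@le_trans _ _ ((C3 * e ^+ m.+1 * T) * (2 * C3 * G) `^ ka)).
    apply: ler_pM => //; first exact: powR_ge0.
    apply: (ge0_ler_powR (ltW ka0)) EF; rewrite nnegrE.
      exact: divr_ge0 (normr_ge0 _) (ltW F0).
    exact: mulr_ge0 (mulr_ge0 (ler0n _ 2) (ltW C30)) (ltW G0).
  have Gka : (2 * C3 * G) `^ ka = (2 * C3) `^ ka *
     (e `^ (-2 * ka) * (s `^ (q0%:R * ka) * r `^ (q.+2%:R * ka))).
    by rewrite /G powRM ?(ltW G0) ?powRM ?mulr_ge0 ?powR_ge0 ?(ltW C30)// -!powRrM.
  rewrite Gka.
  have -> : C3 * e ^+ m.+1 * T * ((2 * C3) `^ ka *
     (e `^ (-2 * ka) * (s `^ (q0%:R * ka) * r `^ (q.+2%:R * ka)))) =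
     C3 * (2 * C3) `^ ka * ((e ^+ m.+1 * e `^ (-2 * ka)) *
       (s `^ (al + q0%:R) * s `^ (q0%:R * ka)) *
       (r `^ (q.+2%:R - l%:R) * r `^ (q.+2%:R * ka))) by rewrite /T; ring.
  rewrite -powR_mulrn ?(ltW e0)// -!powRDp// -[leRHS]mulrA ler_wpM2l ?mulr_ge0 ?powR_ge0 ?(ltW C30)//.
  rewrite exprV_powR//; apply: ler_pM; rewrite ?mulr_ge0 ?powR_ge0//; last first.
    by apply: ler_powR => //; lra.
  rewrite -[leRHS]mul1r; apply: ler_pM; rewrite ?powR_ge0//.
    rewrite -[leRHS](powRr0 e); apply: ger_powR; first by rewrite e0.
    by rewrite -natr1; lra.
  apply: ger_powR; first by rewrite s0.
  have : 0 <= q0%:R * ka by rewrite mulr_ge0// ltW.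
  lra.
Qed.

(** * Sums over a lattice *)

(* The indices are added cyclically, so that translations are bijections; this is harmless since
   all test functions vanish near the faces of the box. *)
Local Notation idx n M := {ffun 'I_n -> 'I_(2 * M).+2}.

Definition unit_step (n M : nat) (i : 'I_n) : idx n M :=
  [ffun j => if j == i then 1 else 0].

(** Coordinates run from [- d M] to [d (M + 1)]; a function with box support of half-width [d M]
    vanishes at both extremes. *)
Definition lattice_point (R : realType) (n M : nat) (d : R) (m : idx n M) :
    'rV[R]_n :=
  \row_i (d * ((m i : nat)%:R - M%:R)).

Definition box_supported (R : realType) (n : nat) (L : R) (f : 'rV[R]_n -> R) : Prop :=
  forall (x : 'rV[R]_n), (exists i : 'I_n, L <= `|x 0 i|) -> f x = 0.

Lemma lattice_point_succ (R : realType) (n M : nat) (d : R) (m : idx n M) (i : 'I_n) :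
  (m i < (2 * M).+1)%N ->
  lattice_point d (m + unit_step M i) = lattice_point d m + d *: delta_mx 0 i.
Proof.
move=> mi; apply/rowP => j; rewrite !mxE !ffunE eqxx.
case: (eqVneq j i) => [->|ji]; last by rewrite addr0 mulr0 addr0.
rewrite /= mulr1.
rewrite [(1 %% _)%N]modn_small// addn1 modn_small// -natr1; ring.
Qed.

Lemma lattice_point_pred (R : realType) (n M : nat) (d : R) (m : idx n M) (i : 'I_n) :
  (0 < m i)%N ->
  lattice_point d (m - unit_step M i) = lattice_point d m - d *: delta_mx 0 i.
Proof.
have [m' ->] : exists m', m = m' + unit_step M i.
  by exists (m - unit_step M i); rewrite subrK.
rewrite addrK => mi; rewrite lattice_point_succ ?addrK//.
rewrite ltn_neqAle -ltnS ltn_ord andbT; apply/eqP => h.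
by move: mi; rewrite !ffunE eqxx /= h [(1 %% _)%N]modn_small// addn1 modnn.
Qed.

(** Where the cyclic successor wraps around, the true neighbour lies outside the box and the cyclic
    one on the opposite face; [f] vanishes at both. *)
Lemma box_supported_succ (R : realType) (n M : nat) (d : R) (f : 'rV[R]_n -> R) (m : idx n M) (i : 'I_n) :
  0 < d -> box_supported (d * M%:R) f ->
  f (lattice_point d (m + unit_step M i)) = f (lattice_point d m + d *: delta_mx 0 i).
Proof.
move=> d0 hf; have [h|h] := ltnP (m i) (2 * M).+1.
  by rewrite lattice_point_succ.
have mi : m i = (2 * M).+1 :> nat.
  by apply/eqP; rewrite eqn_leq h -ltnS ltn_ord.
have M0 : 0 <= M%:R :> R by [].
rewrite !hf//; exists i; rewrite !mxE ?ffunE ?eqxx/= mi.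
  rewrite mulr1 -natr1 natrM.
  have -> : d * (2 * M%:R + 1 - M%:R) + d = d * (M%:R + 2) by ring.
  by rewrite ger0_norm; nra.
by rewrite [(1 %% _)%N]modn_small// addn1 modnn sub0r mulrN normrN ger0_norm// mulr_ge0// ltW.
Qed.

Lemma box_supported_pred (R : realType) (n M : nat) (d : R) (f : 'rV[R]_n -> R) (m : idx n M) (i : 'I_n) :
  0 < d -> box_supported (d * M%:R) f ->
  f (lattice_point d (m - unit_step M i)) = f (lattice_point d m - d *: delta_mx 0 i).
Proof.
move=> d0 hf; have [h|h] := posnP (m i : nat); last by rewrite lattice_point_pred.
have M0 : 0 <= M%:R :> R by [].
move: h; have [m' ->] : exists m', m = m' + unit_step M i.
  by exists (m - unit_step M i); rewrite subrK.
rewrite addrK => h.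
have m'i : m' i = (2 * M).+1 :> nat.
  apply/eqP; rewrite eqn_leq -ltnS ltn_ord/= leqNgt; apply/negP => lt.
  by move: h; rewrite !ffunE eqxx /= [(1 %% _)%N]modn_small// addn1 modn_small.
rewrite !hf//; exists i; last first.
  rewrite !mxE m'i -natr1 natrM.
  have -> : d * (2 * M%:R + 1 - M%:R) = d * (M%:R + 1) by ring.
  by rewrite ger0_norm; nra.
rewrite /lattice_point !mxE h !eqxx mulr1.
by rewrite ler0_norm; nra.
Qed.

Lemma lattice_sum_by_parts (R : realType) (n M : nat) (e : idx n M)
    (a b : idx n M -> R) :
  \sum_(m : idx n M) b m * (a (m + e) - 2 * a m + a (m - e)) =
  \sum_(m : idx n M) a m * (b (m + e) - 2 * b m + b (m - e)).
Proof.
have s1 (f g : idx n M -> R) :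
    \sum_(m : idx n M) f m * g (m + e) = \sum_(m : idx n M) f (m - e) * g m.
  by rewrite (reindex_inj (addIr (- e))) /=; apply: eq_bigr => m _; rewrite subrK.
transitivity (\sum_(m : idx n M) b m * a (m + e) - 2 * \sum_(m : idx n M) b m * a m + \sum_(m : idx n M) a (m - e) * b m).
  rewrite mulr_sumr -sumrB -big_split /=; apply: eq_bigr => m _; ring.
transitivity (\sum_(m : idx n M) a m * b (m + e) - 2 * \sum_(m : idx n M) a m * b m + \sum_(m : idx n M) b (m - e) * a m).
  rewrite !s1 -addrA [- _ + _]addrC addrA [X in X - _]addrC addrAC.
  do 2 congr (_ + _); first by congr (- (2 * _)); apply: eq_bigr => m _; rewrite mulrC.
rewrite mulr_sumr -sumrB -big_split /=; apply: eq_bigr => m _; ring.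
Qed.

(** Time is not made cyclic: the boundary term at 0 is where the initial data enter. *)
Lemma time_sum_by_parts (R : realType) (J : nat) (a b : nat -> R) :
  \sum_(1 <= j < J.+1) b j * (a j.+1 - 2 * a j + a j.-1) =
  \sum_(1 <= j < J.+1) a j * (b j.+1 - 2 * b j + b j.-1)
    + (a J.+1 * b J - a J * b J.+1) - (a 1%N * b 0%N - a 0%N * b 1%N).
Proof.
elim: J => [|J IH]; first by rewrite !big_geq//; ring.
by rewrite !(big_nat_recr J.+1)//= IH; ring.
Qed.

Definition second_diff_t (R : realType) (n : nat) (d : R) (u : R -> 'rV[R]_n -> R) (t : R)
    (x : 'rV[R]_n) : R :=
  (u (t + d) x - 2 * u t x + u (t - d) x) / d ^+ 2.

Definition second_diff_x (R : realType) (n : nat) (d : R) (u : R -> 'rV[R]_n -> R) (i : 'I_n)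
    (t : R) (x : 'rV[R]_n) : R :=
  (u t (x + d *: delta_mx 0 i) - 2 * u t x + u t (x - d *: delta_mx 0 i)) / d ^+ 2.

Definition discrete_wave (R : realType) (n : nat) (d : R) (u : R -> 'rV[R]_n -> R) (c : R -> R)
    (t : R) (x : 'rV[R]_n) : R :=
  second_diff_t d u t x - \sum_(i < n) second_diff_x d u i t x + c t * u t x.

Lemma box_supported_interior (R : realType) (n M : nat) (d : R) (f : 'rV[R]_n -> R) (m : idx n M) (i : 'I_n) :
  0 < d -> box_supported (d * M%:R) f -> f (lattice_point d m) != 0 -> (0 < m i < (2 * M).+1)%N.
Proof.
move=> d0 hf fm; have M0 : 0 <= M%:R :> R by [].
apply/andP; split; rewrite ltnNge; apply/negP => h; move/eqP: fm; apply; apply: hf; exists i; rewrite mxE.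
  by move: h; rewrite leqn0 => /eqP ->; rewrite sub0r mulrN normrN ger0_norm// mulr_ge0// ltW.
have mi : m i = (2 * M).+1 :> nat by apply/eqP; rewrite eqn_leq h -ltnS ltn_ord.
rewrite mi -natr1 natrM.
have -> : d * (2 * M%:R + 1 - M%:R) = d * (M%:R + 1) by ring.
by rewrite ger0_norm; nra.
Qed.

(** The exact discrete Green identity. Since [u 0 = 0] and [f] vanishes at the last two times, the
    only boundary term is [u d] against [f 0]; as [u d] is about [d u_t(0)], it measures the initial
    velocity. *)
Lemma discrete_green (R : realType) (n M J : nat) (d : R) (u f : R -> 'rV[R]_n -> R) (c : R -> R) :
  0 < d -> (forall t, 0 <= t -> box_supported (d * M%:R) (f t)) ->
  (forall x, u 0 x = 0) -> (forall x, f (d * J%:R) x = 0) -> (forall x, f (d * J.+1%:R) x = 0) ->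
  \sum_(1 <= j < J.+1) \sum_(m : idx n M)
     f (d * j%:R) (lattice_point d m) * discrete_wave d u c (d * j%:R) (lattice_point d m) =
  \sum_(1 <= j < J.+1) \sum_(m : idx n M)
     u (d * j%:R) (lattice_point d m) * discrete_wave d f c (d * j%:R) (lattice_point d m)
  - (\sum_(m : idx n M) u d (lattice_point d m) * f 0 (lattice_point d m)) / d ^+ 2.
Proof.
move=> d0 hf u0 fJ fJ1.
pose T (a b : R -> 'rV[R]_n -> R) := \sum_(1 <= j < J.+1) \sum_(m : idx n M)
     b (d * j%:R) (lattice_point d m) * second_diff_t d a (d * j%:R) (lattice_point d m).
pose S (a b : R -> 'rV[R]_n -> R) := \sum_(1 <= j < J.+1) \sum_(m : idx n M)
     b (d * j%:R) (lattice_point d m) *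
     \sum_(i < n) second_diff_x d a i (d * j%:R) (lattice_point d m).
pose Z (a b : R -> 'rV[R]_n -> R) := \sum_(1 <= j < J.+1) \sum_(m : idx n M)
     b (d * j%:R) (lattice_point d m) * (c (d * j%:R) * a (d * j%:R) (lattice_point d m)).
have split_wave a b : \sum_(1 <= j < J.+1) \sum_(m : idx n M)
     b (d * j%:R) (lattice_point d m) * discrete_wave d a c (d * j%:R) (lattice_point d m) =
     T a b - S a b + Z a b.
  rewrite /T /S /Z -sumrB -big_split /=; apply: eq_bigr => j _.
  rewrite -sumrB -big_split /=; apply: eq_bigr => m _.
  by rewrite /discrete_wave; ring.
have ZE : Z u f = Z f u.
  by apply: eq_bigr => j _; apply: eq_bigr => m _; ring.
have dpos : d != 0 by rewrite gt_eqF.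
have TE : T u f = T f u - (\sum_(m : idx n M) u d (lattice_point d m) * f 0 (lattice_point d m)) / d ^+ 2.
  rewrite /T exchange_big [in RHS]exchange_big /= mulr_suml -sumrB; apply: eq_bigr => m _.
  set x := lattice_point d m.
  have tp (j : nat) : d * j%:R + d = d * j.+1%:R by rewrite -natr1; ring.
  have tm (j : nat) : (0 < j)%N -> d * j%:R - d = d * j.-1%:R.
    by case: j => // j _; rewrite -natr1/=; ring.
  have sd (a b : R -> 'rV[R]_n -> R) :
      \sum_(1 <= j < J.+1) b (d * j%:R) x * second_diff_t d a (d * j%:R) x =
      (\sum_(1 <= j < J.+1) b (d * j%:R) x *
        (a (d * j.+1%:R) x - 2 * a (d * j%:R) x + a (d * j.-1%:R) x)) / d ^+ 2.
    rewrite mulr_suml big_nat [in RHS]big_nat; apply: eq_bigr => j /andP[j0 _].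
    by rewrite /second_diff_t tp tm// mulrA.
  rewrite !sd.
  have := time_sum_by_parts J (fun j => u (d * j%:R) x) (fun j => f (d * j%:R) x).
  by rewrite /= => ->; rewrite mulr1 mulr0 fJ fJ1 u0; field.
have SE : S u f = S f u.
  rewrite /S; apply: eq_bigr => j _; have : 0 <= d * j%:R by rewrite mulr_ge0// ltW.
  move: (d * j%:R) => t t0.
  pose a (m : idx n M) := u t (lattice_point d m); pose b (m : idx n M) := f t (lattice_point d m).
  transitivity (\sum_(i < n) (\sum_(m : idx n M) b m * (a (m + unit_step M i) - 2 * a m + a (m - unit_step M i))) / d ^+ 2).
    under eq_bigr do rewrite mulr_sumr.
    rewrite exchange_big; apply: eq_bigr => i _; rewrite mulr_suml; apply: eq_bigr => m _.
    (* [u] has no compact support, so its cyclic neighbours are used only at points where [f] is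
       nonzero, and these are interior. *)
    have [fm|fm] := eqVneq (f t (lattice_point d m)) 0; first by rewrite /b fm !mul0r.
    have /andP[m1 m2] := box_supported_interior i d0 (hf t t0) fm.
    by rewrite /second_diff_x /a lattice_point_succ// lattice_point_pred// mulrA.
  transitivity (\sum_(i < n) (\sum_(m : idx n M) a m * (b (m + unit_step M i) - 2 * b m + b (m - unit_step M i))) / d ^+ 2).
    by apply: eq_bigr => i _; rewrite lattice_sum_by_parts.
  under [RHS]eq_bigr do rewrite mulr_sumr.
  rewrite [RHS]exchange_big; apply: eq_bigr => i _; rewrite mulr_suml; apply: eq_bigr => m _.
  by rewrite /second_diff_x /b (box_supported_succ _ _ d0 (hf t t0)) (box_supported_pred _ _ d0 (hf t t0)) mulrA.
by rewrite !split_wave TE SE ZE; ring.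
Qed.

Lemma card_lattice (n M : nat) : #|{: idx n M}| = ((2 * M).+2 ^ n)%N.
Proof. by rewrite card_ffun !card_ord. Qed.

(** Testing bounds the sum of [f N] by the sum of [u E(f)] minus the data term, up to errors;
    Young's inequality bounds [u E(f)] by [f N + b]. The nonlinear sums cancel, and the data are
    bounded by [b] alone. *)
Lemma discrete_blowup_bound (R : realType) (n M J : nat) (d eta B : R)
    (u f N : R -> 'rV[R]_n -> R) (c : R -> R) (b : 'rV[R]_n -> R) :
  0 < d -> 0 <= eta ->
  (forall t, 0 <= t -> box_supported (d * M%:R) (f t)) ->
  (forall x, u 0 x = 0) -> (forall x, f (d * J%:R) x = 0) -> (forall x, f (d * J.+1%:R) x = 0) ->
  (forall j x, (1 <= j <= J)%N -> 0 <= f (d * j%:R) x <= B) ->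
  (forall j (m : idx n M), (1 <= j <= J)%N -> let t := d * j%:R in let x := lattice_point d m in
     f t x != 0 -> N t x <= discrete_wave d u c t x + eta) ->
  (forall j (m : idx n M), (1 <= j <= J)%N -> let t := d * j%:R in let x := lattice_point d m in
     u t x * discrete_wave d f c t x <= f t x * N t x + b x + eta) ->
  (\sum_(m : idx n M) u d (lattice_point d m) * f 0 (lattice_point d m)) / d ^+ 2 <=
  J%:R * (\sum_(m : idx n M) b (lattice_point d m))
    + J%:R * ((2 * M).+2 ^ n)%:R * (eta * (1 + B)).
Proof.
move=> d0 eta0 hf u0 fJ fJ1 f0 hN hu.
have := discrete_green c d0 hf u0 fJ fJ1.
set X := _ / d ^+ 2 => green.
set A1 := \sum_(1 <= j < J.+1) _ in green.
set A2 := \sum_(1 <= j < J.+1) _ in green.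
pose A3 := \sum_(1 <= j < J.+1) \sum_(m : idx n M)
  f (d * j%:R) (lattice_point d m) * N (d * j%:R) (lattice_point d m).
pose e (s : R) := J%:R * ((2 * M).+2 ^ n)%:R * s.
have sum_e (s : R) : \sum_(1 <= j < J.+1) \sum_(m : idx n M) s = e s.
  by rewrite big_const_nat iter_addr_0 sumr_const card_lattice subSS subn0 /e -natrM mulr_natl mulrnA mulrnAC.
have h1 : A3 - e (eta * B) <= A1.
  rewrite /A1 /A3 -sum_e -sumrB /= [leLHS]big_nat [leRHS]big_nat; apply: ler_sum => j hj.
  rewrite -sumrB; apply: ler_sum => m _.
  have /andP[fj0 fjB] := f0 j (lattice_point d m) hj.
  have [fz|fz] := eqVneq (f (d * j%:R) (lattice_point d m)) 0.
    by rewrite fz !mul0r sub0r oppr_le0 mulr_ge0// (le_trans fj0).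
  have h := hN j m hj fz; rewrite lerBlDr.
  apply: le_trans (ler_wpM2l fj0 h) _.
  by rewrite mulrDr lerD2l mulrC ler_wpM2l.
have h2 : A2 <= A3 + J%:R * (\sum_(m : idx n M) b (lattice_point d m)) + e eta.
  have -> : J%:R * (\sum_(m : idx n M) b (lattice_point d m)) =
     \sum_(1 <= j < J.+1) \sum_(m : idx n M) b (lattice_point d m).
    by rewrite big_const_nat iter_addr_0 subSS subn0 mulr_natl.
  rewrite /A2 /A3 -sum_e -!big_split /= [leLHS]big_nat [leRHS]big_nat; apply: ler_sum => j hj.
  by rewrite -!big_split; apply: ler_sum => m _; exact: hu.
have -> : J%:R * ((2 * M).+2 ^ n)%:R * (eta * (1 + B)) = e eta + e (eta * B).
  by rewrite /e; ring.
move: h1 h2; rewrite green; lra.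
Qed.

(** Comparison with a telescoping sum: [1 / (1 + y^2) <= 4 / ((1 + y) (1 + y + h))] for [h <= 1],
    and the right-hand side is [4 / h] times a difference of values of [1 / (1 + y)]. The bound does
    not depend on [P]. *)
Lemma sum_inv_sqr (R : realType) (h : R) (P : nat) : 0 < h <= 1 ->
  \sum_(j < P) (1 + (h * j%:R) ^+ 2)^-1 <= 4 / h.
Proof.
move=> /andP[h0 h1].
have step (j : nat) : (1 + (h * j%:R) ^+ 2)^-1 <= 4 / h * ((1 + h * j%:R)^-1 - (1 + h * j.+1%:R)^-1).
  have hj : 0 <= h * j%:R by rewrite mulr_ge0// ltW.
  set y := h * j%:R in hj *.
  have -> : h * j.+1%:R = y + h by rewrite -natr1 mulrDr mulr1.
  have y1 : 0 < 1 + y by lra.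
  have y2 : 0 < 1 + (y + h) by lra.
  have -> : 4 / h * ((1 + y)^-1 - (1 + (y + h))^-1) = 4 / ((1 + y) * (1 + (y + h))).
    by field; rewrite !gt_eqF.
  have y3 : 0 < 1 + y ^+ 2 by have := sqr_ge0 y; lra.
  rewrite ler_pdivlMr ?mulr_gt0// mulrC ler_pdivrMr//.
  have := sqr_ge0 (y - 1); rewrite !expr2; nra.
apply: le_trans (ler_sum _ (fun (j : 'I_P) _ => step j)) _.
rewrite -mulr_sumr -[leRHS]mulr1 ler_wpM2l ?divr_ge0 ?(ltW h0)//.
rewrite -(big_mkord xpredT (fun j => (1 + h * j%:R)^-1 - (1 + h * j.+1%:R)^-1)).
have -> : \sum_(0 <= j < P) ((1 + h * j%:R)^-1 - (1 + h * j.+1%:R)^-1) =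
   - \sum_(0 <= j < P) ((1 + h * j.+1%:R)^-1 - (1 + h * j%:R)^-1).
  by rewrite -sumrN; apply: eq_bigr => j _; rewrite opprB.
rewrite telescope_sumr// opprB mulr0 addr0 invr1 lerBlDr lerDl invr_ge0.
by rewrite addr_ge0// mulr_ge0// ltW.
Qed.

Lemma lattice_line_sum (R : realType) (h : R) (M : nat) : 0 < h <= 1 ->
  \sum_(k < (2 * M).+2) (1 + (h * (k%:R - M%:R)) ^+ 2)^-1 <= 8 / h.
Proof.
move=> hh.
rewrite -(big_mkord xpredT (fun k => (1 + (h * (k%:R - M%:R)) ^+ 2)^-1)).
rewrite (big_cat_nat (n := M)) //=; last by rewrite ltnW// ltnW// ltnS; lia.
have -> : 8 / h = 4 / h + 4 / h by field; case/andP: hh => h0 _; rewrite gt_eqF.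
apply: lerD.
  rewrite big_nat_rev big_mkord.
  apply: le_trans (@sum_inv_sqr R h M.+1 hh).
  rewrite big_ord_recl /= [leLHS](_ : _ = \sum_(j < M) (1 + (h * (bump 0 j)%:R) ^+ 2)^-1).
    by rewrite lerDr invr_ge0 mulr0 expr0n addr0.
  apply: eq_bigr => j _; congr (1 + _)^-1.
  rewrite /bump add1n add0n natrB//; ring.
rewrite -{1}[M]add0n big_addn big_mkord.
apply: le_trans (@sum_inv_sqr R h ((2 * M).+2 - M) hh).
by apply: ler_sum => j _; rewrite natrD addrK.
Qed.

Definition radius_weight (R : realType) (n : nat) (r : R) (x : 'rV[R]_n) : R :=
  1 + (\sum_(i < n) x 0 i ^+ 2) / r ^+ 2.

Lemma radius_weight_ge1 (R : realType) (n : nat) (r : R) (x : 'rV[R]_n) :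
  1 <= radius_weight r x.
Proof.
by rewrite lerDl divr_ge0 ?sqr_ge0// sumr_ge0// => i _; exact: sqr_ge0.
Qed.

(** Each of the [n] factors of the weight is bounded below by [1 + (x_i / r)^2] for its own
    coordinate, so the sum is dominated by a product of one-dimensional sums, uniformly in [M]. *)
Lemma lattice_weight_sum (R : realType) (n M : nat) (d r : R) : 0 < d <= r ->
  \sum_(m : idx n M) (radius_weight r (lattice_point d m))^-1 ^+ n <= (8 * r / d) ^+ n.
Proof.
move=> /andP[d0 dr]; have r0 : 0 < r by exact: lt_le_trans dr.
pose g (k : 'I_(2 * M).+2) : R := (1 + (d / r * (k%:R - M%:R)) ^+ 2)^-1.
have g0 k : 0 <= g k by rewrite invr_ge0 addr_ge0// sqr_ge0.
have hb : \sum_k g k <= 8 * r / d.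
  apply: le_trans (@lattice_line_sum R (d / r) M _) _.
    by rewrite divr_gt0//= ler_pdivrMr// mul1r.
  by rewrite le_eqVlt; apply/orP; left; apply/eqP; field; rewrite !gt_eqF.
apply: (@le_trans _ _ (\sum_(m : idx n M) \prod_(i < n) g (m i))).
  apply: ler_sum => m _.
  rewrite -[X in _ ^+ X]card_ord -prodr_const; apply: ler_prod => i _.
  have w1 := radius_weight_ge1 r (lattice_point d m).
  rewrite invr_ge0 (le_trans ler01 w1)/= lef_pV2 ?posrE; last 2 first.
  - exact: lt_le_trans w1.
  - by have := sqr_ge0 (d / r * ((m i)%:R - M%:R)); lra.
  rewrite lerD2l (bigD1 i)//= mxE mulrDl.
  have -> : (d / r * ((m i)%:R - M%:R)) ^+ 2 = (d * ((m i)%:R - M%:R)) ^+ 2 / r ^+ 2.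
    by field; rewrite gt_eqF.
  rewrite lerDl divr_ge0 ?sqr_ge0// sumr_ge0// => j _; exact: sqr_ge0.
rewrite -(bigA_distr_bigA (fun (_ : 'I_n) k => g k)) /= prodr_const card_ord.
by rewrite lerXn2r ?nnegrE// ?sumr_ge0// (le_trans _ hb)// sumr_ge0.
Qed.

(** Only the [P^n] points of a cube in the nonnegative orthant are kept. *)
Lemma lattice_sum_lower_bound (R : realType) (n M P : nat) (c : R) (f : idx n M -> R) :
  (P <= M)%N -> (forall m, 0 <= f m) ->
  (forall m : idx n M, (forall i, (M <= m i < M + P)%N) -> c <= f m) ->
  c * P%:R ^+ n <= \sum_m f m.
Proof.
move=> PM f0 hf.
pose D : pred 'I_(2 * M).+2 := fun k => (M <= k < M + P)%N.
have cD : #|D| = P.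
  rewrite -sum1_card -(big_mkord (fun k => M <= k < M + P)%N (fun=> 1%N)).
  rewrite (big_cat_nat (n := M))//=; last by lia.
  rewrite big_nat_cond big1 ?add0n; last by move=> k; lia.
  rewrite (big_cat_nat (n := (M + P)%N))//=; [|lia|lia].
  rewrite [X in (_ + X)%N]big_nat_cond [X in (_ + X)%N]big1 ?addn0; last by move=> k; lia.
  rewrite big_nat_cond (eq_bigl (fun k => (M <= k < M + P)%N)); last by move=> k; lia.
  by rewrite -big_nat sum_nat_const_nat muln1; lia.
rewrite (bigID (mem (ffun_on D))) /=.
have -> : c * P%:R ^+ n = \sum_(m : idx n M | m \in ffun_on D) c.
  by rewrite sumr_const card_ffun_on card_ord cD -natrX mulr_natr.
rewrite -[leLHS]addr0 lerD//; last by rewrite sumr_ge0.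
by apply: ler_sum => m /ffun_onP hm; exact: hf.
Qed.

(** * The Liouville transform *)

(** Within distance [t] of [t > 0] the restriction [0 <= s] in [time_filter] holds automatically. *)
Lemma is_derive_dt (R : realType) (n : nat) (v : R -> 'rV[R]_n -> R) (t : R) (x : 'rV[R]_n) :
  0 < t -> derivable_t v t x -> is_derive t 1 (v^~ x) (dt v t x).
Proof.
move=> t0 /cvg_ex[l hl].
have PF : ProperFilter (time_filter t).
  split; last exact: within_filter.
  rewrite /time_filter /within /= => h.
  have /filter_ex[s []] : \forall s \near t^', (0 <= s -> False) /\ 0 < s.
    apply: filterI; first exact: h.
    by apply: nbhs_dnbhs; exact: lt_nbhsr.
  by move=> hs s0; apply: hs; exact: ltW.
have lE : dt v t x = l by apply: cvg_lim hl.
suff H : (fun h : R => h^-1 *: (v (h *: 1 + t) x - v t x)) @ 0^' --> l.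
  by rewrite lE; split; [apply/cvg_ex; exists l|exact: cvg_lim H].
apply/cvgrPdist_lt => e e0.
have /cvgrPdist_lt/(_ _ e0) := hl.
rewrite /time_filter => /nbhs_ballP[r /= r0 hr].
apply/nbhs_ballP; exists (Num.min r t) => /=; first by rewrite lt_min r0.
move=> h; rewrite /ball /= sub0r normrN lt_min => /andP[hr' ht] h0.
have := hr (h + t); rewrite /ball /= opprD addrCA subrr addr0 normrN => /(_ hr').
have ht' : 0 <= h + t by move: ht; rewrite ltr_norml => /andP[]; lra.
have hn : h + t != t by rewrite -subr_eq0 addrK.
move=> /(_ hn ht'); rewrite /time_quotient addrK /GRing.scale /= mulr1.
by rewrite [_^-1 * _]mulrC.
Qed.

Lemma is_derive_dx (R : realType) (n : nat) (f : 'rV[R]_n -> R) (i : 'I_n) (x : 'rV[R]_n) (s : R) :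
  derivable_x i f (x + s *: delta_mx 0 i) ->
  is_derive s 1 (fun s => f (x + s *: delta_mx 0 i)) (dx i f (x + s *: delta_mx 0 i)).
Proof.
move=> df.
have E : (fun h : R => h^-1 *: (f (x + (h *: 1 + s) *: delta_mx 0 i) - f (x + s *: delta_mx 0 i))) =
  (fun h : R => h^-1 *: (f (h *: delta_mx 0 i + (x + s *: delta_mx 0 i)) - f (x + s *: delta_mx 0 i))).
  apply/funext => h; rewrite [h *: 1]mulr1.
  by rewrite scalerDl addrCA.
by split; [rewrite /derivable /= E|rewrite /derive /= E].
Qed.

Section Strip.
Variables (R : realType) (n : nat) (T : R).

Definition strip_continuous (f : R -> 'rV[R]_n -> R) : Prop :=
  {within strip T, continuous (fun z : R * 'rV[R]_n => f z.1 z.2)}.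

Lemma strip_continuousM (f g : R -> 'rV[R]_n -> R) : strip_continuous f -> strip_continuous g ->
  strip_continuous (fun t x => f t x * g t x).
Proof.
move=> /subspace_continuousP cf /subspace_continuousP cg.
by apply/subspace_continuousP => z hz; apply: cvgM; [exact: cf|exact: cg].
Qed.

Lemma strip_continuousD (f g : R -> 'rV[R]_n -> R) : strip_continuous f -> strip_continuous g ->
  strip_continuous (fun t x => f t x + g t x).
Proof.
move=> /subspace_continuousP cf /subspace_continuousP cg.
by apply/subspace_continuousP => z hz; apply: cvgD; [exact: cf|exact: cg].
Qed.

Lemma strip_continuous_time (w : R -> R) : (forall t, 0 <= t -> {for t, continuous w}) ->
  strip_continuous (fun t _ => w t).
Proof.
move=> cw; apply/subspace_continuousP => z /andP[z0 _]; apply: cvg_within_filter.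
by apply: (@continuous_comp _ _ _ fst w); [exact: cvg_fst|exact: cw].
Qed.

Lemma strip_continuous_slice (f : R -> 'rV[R]_n -> R) (x : 'rV[R]_n) (a b : R) :
  strip_continuous f -> 0 <= a -> b < T -> {within `[a, b], continuous (f^~ x)}.
Proof.
move=> cf a0 bT.
apply: (@within_continuous_comp _ _ _ _ (strip T) (fun t : R => (t, x)) _ _ _ cf).
  apply: continuous_subspaceT => t.
  have h1 : (fun t : R => t) @ t --> t by exact: cvg_id.
  have h2 : (fun=> x) @ t --> x by exact: cvg_cst.
  exact: cvg_pair h1 h2.
by move=> t /=; rewrite in_itv /= /strip /=; lra.
Qed.

End Strip.

(* Differentiability of [u] is recorded in the mean value form in which the lattice sums use it. *)
Record wave_solution (R : realType) (n : nat) (c p w T : R) (v1 : 'rV[R]_n -> R)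
    (u ut utt : R -> 'rV[R]_n -> R) (uxx : 'I_n -> R -> 'rV[R]_n -> R) : Prop := {
  wave_tt : forall t h x, 0 < h -> 0 <= t - h -> t + h < T -> exists2 xi, t - h < xi < t + h &
    u (t + h) x - 2 * u t x + u (t - h) x = h ^+ 2 * utt xi x;
  wave_t : forall h x, 0 < h < T -> exists2 xi, 0 < xi < h & u h x = h * ut xi x;
  wave_xx : forall t h x i, 0 <= t < T -> 0 < h -> exists2 xi, - h < xi < h &
    u t (x + h *: delta_mx 0 i) - 2 * u t x + u t (x - h *: delta_mx 0 i) =
      h ^+ 2 * uxx i t (x + xi *: delta_mx 0 i);
  wave_cont : strip_continuous T u;
  wave_cont_t : strip_continuous T ut;
  wave_cont_tt : strip_continuous T utt;
  wave_cont_xx : forall i, strip_continuous T (uxx i);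
  wave_eq : forall t x, 0 <= t < T ->
    utt t x - \sum_(i < n) uxx i t x + c / (1 + t) ^+ 2 * u t x = (1 + t) `^ w * `|u t x| `^ p;
  wave_0 : forall x, u 0 x = 0;
  wave_1 : forall x, ut 0 x = v1 x
}.

Lemma liouville_transform (R : realType) (n : nat) (mu nu p T : R) (v1 : 'rV[R]_n -> R)
    (v : R -> 'rV[R]_n -> R) :
  0 < T -> classical_solution mu nu p v1 T v ->
  exists u ut utt uxx, wave_solution (nu - mu / 2 * (mu / 2 - 1)) p (- (mu / 2 * (p - 1))) T v1
    u ut utt uxx.
Proof.
move=> T0 [[cv [[dtv [cdtv [[dttv [cdttv _]] _]]] dxv]] veq v0 v1E].
pose m := mu / 2.
pose W b (t : R) : R := (1 + t) `^ b.
have dW b (t : R) : 0 <= t -> is_derive t 1 (W b) (b * W (b - 1) t).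
  move=> t0; have h : 0 < 1 + t by lra.
  have d1 : is_derive t 1 (fun t : R => 1 + t) 1.
    by apply: trigger_derive; rewrite /GRing.scale/=; ring.
  have d2 := is_derive1_powR b h.
  exact: (trigger_derive (@is_derive1_comp R ((@powR R)^~ b) (fun t : R => 1 + t) t _ _ d2 d1)) (mulr1 _).
have W1 b (t : R) : 0 <= t -> W (b - 1) t = W b t / (1 + t).
  by move=> t0; rewrite /W powRDp ?powR_inv1//; lra.
have cW b : strip_continuous T (fun t (_ : 'rV[R]_n) => W b t).
  by apply: strip_continuous_time => t t0; apply: is_derive_continuous; exact: dW.
have cc (a : R) : strip_continuous T (fun _ (_ : 'rV[R]_n) => a).
  by apply: strip_continuous_time => t t0; exact: cvg_cst.
pose u t x := W m t * v t x.
pose ut t x := W m t * dt v t x + m * W (m - 1) t * v t x.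
pose utt t x := W m t * dt (dt v) t x + 2 * m * W (m - 1) t * dt v t x
   + m * (m - 1) * W (m - 1 - 1) t * v t x.
pose uxx i t x := W m t * dx i (dx i (v t)) x.
have cu : strip_continuous T u by apply: strip_continuousM.
have cut : strip_continuous T ut.
  apply: strip_continuousD; first exact: strip_continuousM.
  by do 2 apply: strip_continuousM => //.
have du (t : R) x : 0 < t < T -> is_derive t 1 (u^~ x) (ut t x).
  move=> /andP[t0 tT]; have tt : 0 <= t < T by rewrite ltW.
  have d1 := is_derive_dt t0 (dtv _ x tt). have d2 := dW m t (ltW t0).
  by apply: (trigger_derive (is_deriveM d2 d1)); rewrite /ut /GRing.scale/=; ring.
have dut (t : R) x : 0 < t < T -> is_derive t 1 (ut^~ x) (utt t x).
  move=> /andP[t0 tT]; have tt : 0 <= t < T by rewrite ltW.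
  have d1 := is_derive_dt t0 (dtv _ x tt). have d2 := dW m t (ltW t0).
  have d3 := is_derive_dt t0 (dttv _ x tt). have d4 := dW (m - 1) t (ltW t0).
  have d5 := is_deriveM (is_deriveM (is_derive_cst m t 1) d4) d1.
  apply: (trigger_derive (is_deriveD (is_deriveM d2 d3) d5)).
  by rewrite /utt /GRing.scale/= ?fctE /cst; ring.
exists u, ut, utt, uxx; split => //.
- move=> t h x h0 th thT.
  (* Two-sided time derivatives are available for positive times only; when [t - h = 0] the mean
     value theorem relies on continuity up to the boundary. *)
  have cth : {within `[t - h, t + h], continuous (u^~ x)} by exact: strip_continuous_slice.
  have d1 (s : R) : s \in `]t - h, t + h[%R -> is_derive s 1 (u^~ x) (ut s x).
    by rewrite in_itv /= => hs; apply: du; lra.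
  have d2 (s : R) : s \in `]t - h, t + h[%R -> is_derive s 1 (ut^~ x) (utt s x).
    by rewrite in_itv /= => hs; apply: dut; lra.
  have [xi xih ->] := second_difference_mean h0 cth d1 d2.
  by exists xi => //; move: xih; rewrite in_itv.
- move=> h x /andP[h0 hT].
  have c0h : {within `[0, h], continuous (u^~ x)} by exact: strip_continuous_slice.
  have [|xi xih] := MVT (df := ut^~ x) h0 _ c0h.
    by move=> s; rewrite in_itv /= => hs; apply: du; lra.
  rewrite subr0 [u 0 x]/u v0 mulr0 subr0 => ->.
  by exists xi; [move: xih; rewrite in_itv|rewrite mulrC].
- move=> t h x i tT h0.
  have [dx1 [_ dx2]] := dxv i.
  pose f s := v t (x + s *: delta_mx 0 i).
  pose f1 s := dx i (v t) (x + s *: delta_mx 0 i).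
  pose f2 s := dx i (dx i (v t)) (x + s *: delta_mx 0 i).
  have d1 (s : R) : is_derive s 1 f (f1 s) by apply: is_derive_dx; exact: dx1.
  have d2 (s : R) : is_derive s 1 f1 (f2 s).
    by apply: is_derive_dx; have [_ h2] := dx2; have [h3 _] := h2 i; exact: h3.
  have cf : {within `[0 - h, 0 + h], continuous f}.
    by apply: derivable_within_continuous => s _; have [] := d1 s.
  have [xi xih E] := second_difference_mean h0 cf (fun s _ => d1 s) (fun s _ => d2 s).
  exists xi; first by move: xih; rewrite in_itv /= sub0r add0r.
  move: E; rewrite /f sub0r add0r scaleNr scale0r addr0 => E.
  have -> : h ^+ 2 * uxx i t (x + xi *: delta_mx 0 i) = W m t * (h ^+ 2 * f2 xi).
    by rewrite /uxx /f2; ring.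
  by rewrite -E /u; ring.
- apply: strip_continuousD.
    apply: strip_continuousD; first exact: strip_continuousM.
    by do 2 apply: strip_continuousM => //.
  by do 2 apply: strip_continuousM => //.
- move=> i; apply: strip_continuousM => //.
  by have [_ [_ [_ h2]]] := dxv i; have [_ [h3 _]] := h2 i.
- move=> t x tT; have /andP[t0 _] := tT; have h1 : 0 < 1 + t by lra.
  have hn : 1 + t != 0 by rewrite gt_eqF.
  have pE : `|u t x| `^ p = W m t `^ p * `|v t x| `^ p.
    by rewrite /u normrM powRM// ger0_norm// powR_ge0.
  have -> : (1 + t) `^ (- (mu / 2 * (p - 1))) * `|u t x| `^ p = W m t * `|v t x| `^ p.
    rewrite pE mulrA /W -powRrM -powRDp//; congr (_ `^ _ * _); rewrite /m; ring.
  rewrite -veq// /utt /u /uxx -mulr_sumr !W1// /laplacian /m.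
  by field.
- by move=> x; rewrite /u v0 mulr0.
- by move=> x; rewrite /ut v1E v0 mulr0 addr0 /W addr0 powR1 mul1r.
Qed.

(** * The lifespan estimate *)

Definition box (R : realType) (n : nat) (T X : R) : set (R * 'rV[R]_n) :=
  `[0, T] `*` [set x : 'rV[R]_n | forall i, (`[- X, X]%classic : set R) (x ord0 i)].

Lemma compact_box (R : realType) (n : nat) (T X : R) : compact (@box R n T X).
Proof.
apply: compact_setX; first exact: segment_compact.
exact: (@rV_compact R n (fun=> `[- X, X]%classic) (fun=> @segment_compact R _ _)).
Qed.

Section Approximation.
Variables (R : realType) (n : nat) (T T' X : R).
Hypotheses (TT : T' < T).

Lemma box_strip_continuous (f : R -> 'rV[R]_n -> R) :
  strip_continuous T f -> {within @box R n T' X, continuous (fun z : R * 'rV[R]_n => f z.1 z.2)}.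
Proof.
apply: continuous_subspaceW => z [/= + _].
by rewrite /strip /= in_itv /= => /andP[-> h]; exact: le_lt_trans TT.
Qed.

(** Uniform continuity on a compact box. The time [T'] stays below [T] because the solution is
    controlled on the half-open strip only. *)
Lemma strip_uniform (f : R -> 'rV[R]_n -> R) (eta : R) : strip_continuous T f -> 0 < eta ->
  \forall d \near (0:R)^'+, forall t t' (x x' : 'rV[R]_n),
    0 <= t <= T' -> 0 <= t' <= T' -> (forall i, `|x 0 i| <= X) -> (forall i, `|x' 0 i| <= X) ->
    `|t - t'| < d -> (forall i, `|x 0 i - x' 0 i| < d) -> `|f t x - f t' x'| < eta.
Proof.
move=> cf eta0.
have [r r0 hr] := compact_uniformly_continuous (@compact_box R n T' X)
  (box_strip_continuous cf) eta0.
near=> d => t t' x x' ht ht' hx hx' tt' xx'.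
have dr : d < r by near: d; exact: nbhs_right_lt.
apply: (hr (t, x) (t', x')).
- by split => /=; [rewrite in_itv|move=> i; rewrite in_itv /= -ler_norml; exact: hx].
- by split => /=; [rewrite in_itv|move=> i; rewrite in_itv /= -ler_norml; exact: hx'].
- split; first by rewrite /ball /=; exact: lt_trans dr.
  by split => // i j; rewrite /ball /= ord1; exact: lt_trans dr.
Unshelve. all: by end_near. Qed.

Lemma strip_bounded (f : R -> 'rV[R]_n -> R) : strip_continuous T f ->
  exists2 B, 0 <= B & forall t (x : 'rV[R]_n), 0 <= t <= T' -> (forall i, `|x 0 i| <= X) -> `|f t x| <= B.
Proof.
move=> cf; have := continuous_compact (box_strip_continuous cf) (@compact_box R n T' X).
move=> /compact_bounded[B [_ hB]]; exists (`|B| + 1); first by rewrite addr_ge0.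
move=> t x ht hx; apply: (hB (`|B| + 1)); first by rewrite (le_lt_trans (ler_norm B))// ltrDl.
exists (t, x) => //; split => /=; first by rewrite in_itv.
by move=> i; rewrite in_itv /= -ler_norml; exact: hx.
Qed.

Lemma second_diff_t_approx (f ftt : R -> 'rV[R]_n -> R) (eta : R) :
  (forall t h x, 0 < h -> 0 <= t - h -> t + h < T -> exists2 xi, t - h < xi < t + h &
    f (t + h) x - 2 * f t x + f (t - h) x = h ^+ 2 * ftt xi x) ->
  strip_continuous T ftt -> 0 < eta ->
  \forall d \near (0:R)^'+, forall t (x : 'rV[R]_n), 0 <= t - d -> t + d <= T' ->
    (forall i, `|x 0 i| <= X) -> `|second_diff_t d f t x - ftt t x| < eta.
Proof.
move=> hf cf eta0; near=> d => t x td tT hx.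
have d0 : 0 < d by near: d; exact: nbhs_right_gt.
have [xi xid E] := hf t d x d0 td (le_lt_trans tT TT).
have -> : second_diff_t d f t x = ftt xi x.
  by rewrite /second_diff_t E mulrAC divff ?mul1r// expf_neq0// gt_eqF.
move: t xi x xid td tT hx {E}.
(* The intermediate point [xi] depends on [d], so the property asked of small [d] is stated for all
   pairs of nearby points. *)
suff : forall t t' (x x' : 'rV[R]_n),
    0 <= t <= T' -> 0 <= t' <= T' -> (forall i, `|x 0 i| <= X) -> (forall i, `|x' 0 i| <= X) ->
    `|t - t'| < d -> (forall i, `|x 0 i - x' 0 i| < d) -> `|ftt t x - ftt t' x'| < eta.
  move=> H t xi x xid td tT hx; apply: H => //; [lra|lra|rewrite ltr_norml; lra|].
  by move=> i; rewrite subrr normr0.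
by near: d; exact: strip_uniform.
Unshelve. all: by end_near. Qed.

Lemma first_diff_approx (f ft : R -> 'rV[R]_n -> R) (eta : R) :
  (forall h x, 0 < h < T -> exists2 xi, 0 < xi < h & f h x = h * ft xi x) ->
  strip_continuous T ft -> 0 < eta ->
  \forall d \near (0:R)^'+, forall (x : 'rV[R]_n), d <= T' ->
    (forall i, `|x 0 i| <= X) -> `|f d x / d - ft 0 x| < eta.
Proof.
move=> hf cf eta0; near=> d => x dT hx.
have d0 : 0 < d by near: d; exact: nbhs_right_gt.
have [|xi xid E] := hf d x; first by rewrite d0 (le_lt_trans dT).
have -> : f d x / d = ft xi x by rewrite E mulrAC divff ?mul1r// gt_eqF.
move: xi x xid hx dT {E}.
suff : forall t t' (x x' : 'rV[R]_n),
    0 <= t <= T' -> 0 <= t' <= T' -> (forall i, `|x 0 i| <= X) -> (forall i, `|x' 0 i| <= X) ->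
    `|t - t'| < d -> (forall i, `|x 0 i - x' 0 i| < d) -> `|ft t x - ft t' x'| < eta.
  move=> H xi x xid hx dT; apply: H => //; [lra|lra|rewrite ltr_norml; lra|].
  by move=> i; rewrite subrr normr0.
by near: d; exact: strip_uniform.
Unshelve. all: by end_near. Qed.

End Approximation.

Lemma second_diff_x_approx (R : realType) (n : nat) (T T' X : R) (i : 'I_n)
    (f fxx : R -> 'rV[R]_n -> R) (eta : R) : T' < T ->
  (forall t h x, 0 <= t < T -> 0 < h -> exists2 xi, - h < xi < h &
    f t (x + h *: delta_mx 0 i) - 2 * f t x + f t (x - h *: delta_mx 0 i) =
      h ^+ 2 * fxx t (x + xi *: delta_mx 0 i)) ->
  strip_continuous T fxx -> 0 < eta ->
  \forall d \near (0:R)^'+, forall t (x : 'rV[R]_n), 0 <= t <= T' ->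
    (forall i, `|x 0 i| <= X) -> `|second_diff_x d f i t x - fxx t x| < eta.
Proof.
move=> TT hf cf eta0; near=> d => t x tT hx.
have d0 : 0 < d by near: d; exact: nbhs_right_gt.
have d1 : d < 1 by near: d; exact: nbhs_right_lt.
have [|xi xid E] := hf t d x _ d0; first by have := TT; lra.
have -> : second_diff_x d f i t x = fxx t (x + xi *: delta_mx 0 i).
  by rewrite /second_diff_x E mulrAC divff ?mul1r// expf_neq0// gt_eqF.
move: t xi x xid tT hx {E}.
(* The intermediate point may leave the box of half-width [X], by less than [d < 1]; hence the box
   of half-width [X + 1]. *)
suff : forall t t' (x x' : 'rV[R]_n),
    0 <= t <= T' -> 0 <= t' <= T' -> (forall i, `|x 0 i| <= X + 1) -> (forall i, `|x' 0 i| <= X + 1) ->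
    `|t - t'| < d -> (forall i, `|x 0 i - x' 0 i| < d) -> `|fxx t x - fxx t' x'| < eta.
  move=> H t xi x xid tT hx.
  have xiE (j : 'I_n) : `|(xi *: delta_mx (0 : 'I_1) i : 'rV[R]_n) 0 j| < d.
    rewrite !mxE eqxx /=; case: (j == i); last by rewrite mulr0 normr0.
    by rewrite mulr1 ltr_norml.
  apply: H => //.
  - move=> j; rewrite mxE; apply: le_trans (ler_normD _ _) _.
    by rewrite lerD// ltW// (lt_trans (xiE j)).
  - by move=> j; rewrite (le_trans (hx j))// lerDl.
  - by rewrite subrr normr0.
  - by move=> j; rewrite mxE addrAC subrr add0r.
by near: d; exact: (@strip_uniform R n T T' (X + 1) TT _ _ cf eta0).
Unshelve. all: by end_near. Qed.

Definition rescaled (R : realType) (n : nat) (T : R) (F : R -> R -> R) (t : R) (x : 'rV[R]_n) : R :=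
  F ((1 + t) / T) (radius_weight T x).

Definition rescaled_tt (R : realType) (n : nat) (T : R) (Fss : R -> R -> R) (t : R)
    (x : 'rV[R]_n) : R :=
  rescaled T Fss t x / T ^+ 2.

Definition rescaled_xx (R : realType) (n : nat) (T : R) (Fr Frr : R -> R -> R) (i : 'I_n) (t : R)
    (x : 'rV[R]_n) : R :=
  rescaled T Frr t x * (2 * x 0 i / T ^+ 2) ^+ 2 + rescaled T Fr t x * (2 / T ^+ 2).

Lemma radius_weight_shift (R : realType) (n : nat) (T s : R) (x : 'rV[R]_n) (i : 'I_n) :
  radius_weight T (x + s *: delta_mx 0 i) =
  radius_weight T x + (2 * x 0 i * s + s ^+ 2) / T ^+ 2.
Proof.
rewrite /radius_weight -addrA -mulrDl; congr (1 + _ / _).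
rewrite (bigD1 i)//= [in RHS](bigD1 i)//= !mxE !eqxx mulr1.
have -> : \sum_(j < n | j != i) (x + s *: delta_mx 0 i) 0 j ^+ 2 =
   \sum_(j < n | j != i) x 0 j ^+ 2.
  apply: eq_bigr => j ji; rewrite !mxE eqxx /= (negbTE ji) mulr0 addr0 //.
ring.
Qed.

Section Rescaled.
Variables (R : realType) (n : nat) (T : R) (F Fs Fss Fr Frr : R -> R -> R).
Hypotheses (T0 : 0 < T) (dF : slicewise_C2 F Fs Fss Fr Frr).

Let time_pos (t : R) : -1 < t -> 0 < (1 + t) / T.
Proof. by move=> t0; rewrite divr_gt0//; lra. Qed.

Let weight_pos (x : 'rV[R]_n) : 0 < radius_weight T x.
Proof. exact: lt_le_trans (radius_weight_ge1 T x). Qed.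

Lemma rescaled_continuous (G : R -> R -> R) (T' : R) : List.In G [:: F; Fs; Fss; Fr; Frr] ->
  strip_continuous T' (@rescaled R n T G).
Proof.
move=> hG; apply/subspace_continuousP => z /andP[z0 _]; apply: cvg_within_filter.
have c1 : (fun z : R * 'rV[R]_n => (1 + z.1) / T) @ z --> (1 + z.1) / T.
  apply: cvgM; last exact: cvg_cst.
  by apply: cvgD; [exact: cvg_cst|exact: cvg_fst].
have c2 : (fun z : R * 'rV[R]_n => radius_weight T z.2) @ z --> radius_weight T z.2.
  apply: cvgD; first exact: cvg_cst.
  apply: cvgM; last exact: cvg_cst.
  apply: cvg_big => [|i _]; first exact: add_continuous.
  have ci : (fun z : R * 'rV[R]_n => z.2 0 i) @ z --> z.2 0 i.
    apply: (@continuous_comp _ _ _ snd (fun y : 'rV[R]_n => y 0 i)); first exact: cvg_snd.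
    exact: coord_continuous.
  exact (cvgM ci ci).
have c3 : {for z, continuous (fun z : R * 'rV[R]_n => ((1 + z.1) / T, radius_weight T z.2))}.
  exact: cvg_pair c1 c2.
have z1 : -1 < z.1 by lra.
have c4 := slice_cts dF hG (z := ((1 + z.1) / T, radius_weight T z.2)) (time_pos z1) (weight_pos _).
exact: (continuous_comp c3 c4).
Qed.

Lemma rescaled_tt_mean (t h : R) (x : 'rV[R]_n) : 0 < h -> 0 <= t - h ->
  exists2 xi, t - h < xi < t + h &
    rescaled T F (t + h) x - 2 * rescaled T F t x + rescaled T F (t - h) x =
      h ^+ 2 * rescaled_tt T Fss xi x.
Proof.
move=> h0 th.
have dl (s : R) : is_derive s 1 (fun s : R => (1 + s) / T) T^-1.
  by apply: trigger_derive; rewrite /GRing.scale/=; ring.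
pose r := radius_weight T x.
have d1 (s : R) : s \in `]t - h, t + h[%R ->
    is_derive s 1 (fun s => rescaled T F s x) (Fs ((1 + s) / T) r * T^-1).
  rewrite in_itv /= => hs; have s1 : -1 < s by lra.
  exact: (@is_derive1_comp R (F^~ r) (fun s : R => (1 + s) / T) s _ _
    (slice_s1 dF (time_pos s1) (weight_pos x)) (dl s)).
have d2 (s : R) : s \in `]t - h, t + h[%R ->
    is_derive s 1 (fun s => Fs ((1 + s) / T) r * T^-1) (rescaled_tt T Fss s x).
  rewrite in_itv /= => hs; have s1 : -1 < s by lra.
  have d3 := @is_derive1_comp R (Fs^~ r) (fun s : R => (1 + s) / T) s _ _
    (slice_s2 dF (time_pos s1) (weight_pos x)) (dl s).
  apply: (trigger_derive (is_deriveM d3 (is_derive_cst T^-1 s 1))).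
  by rewrite /GRing.scale /= /cst /rescaled_tt /rescaled -/r; field; rewrite gt_eqF.
have ch : {within `[t - h, t + h], continuous (fun s => rescaled T F s x)}.
  apply: derivable_within_continuous => s; rewrite in_itv /= => hs.
  have s1 : -1 < s by lra.
  have [] // := @is_derive1_comp R (F^~ r) (fun s : R => (1 + s) / T) s _ _
    (slice_s1 dF (time_pos s1) (weight_pos x)) (dl s).
have [xi xih ->] := second_difference_mean h0 ch d1 d2.
by exists xi => //; move: xih; rewrite in_itv.
Qed.

Lemma rescaled_xx_mean (t h : R) (x : 'rV[R]_n) (i : 'I_n) : 0 <= t -> 0 < h ->
  exists2 xi, - h < xi < h &
    rescaled T F t (x + h *: delta_mx 0 i) - 2 * rescaled T F t x
      + rescaled T F t (x - h *: delta_mx 0 i) =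
      h ^+ 2 * rescaled_xx T Fr Frr i t (x + xi *: delta_mx 0 i).
Proof.
move=> t0 h0; have t1 : -1 < t by lra.
pose r (s : R) := radius_weight T x + (2 * x 0 i * s + s ^+ 2) / T ^+ 2.
have rE s : r s = radius_weight T (x + s *: delta_mx 0 i) by rewrite radius_weight_shift.
have rpos s : 0 < r s by rewrite rE.
have dr (s : R) : is_derive s 1 r (2 * (x 0 i + s) / T ^+ 2).
  by apply: trigger_derive; rewrite /GRing.scale/=; ring.
pose f s := F ((1 + t) / T) (r s).
pose f1 s := Fr ((1 + t) / T) (r s) * (2 * (x 0 i + s) / T ^+ 2).
pose f2 s := Frr ((1 + t) / T) (r s) * (2 * (x 0 i + s) / T ^+ 2) ^+ 2
   + Fr ((1 + t) / T) (r s) * (2 / T ^+ 2).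
have d1 (s : R) : is_derive s 1 f (f1 s).
  exact: (@is_derive1_comp R _ r s _ _ (slice_r1 dF (time_pos t1) (rpos s)) (dr s)).
have d2 (s : R) : is_derive s 1 f1 (f2 s).
  have d3 := @is_derive1_comp R _ r s _ _ (slice_r2 dF (time_pos t1) (rpos s)) (dr s).
  have d4 : is_derive s 1 (fun s : R => 2 * (x 0 i + s) / T ^+ 2) (2 / T ^+ 2).
    by apply: trigger_derive; rewrite /GRing.scale/=; ring.
  apply: (trigger_derive (is_deriveM d3 d4)).
  by rewrite /GRing.scale /= /f2; ring.
have cf : {within `[0 - h, 0 + h], continuous f}.
  by apply: derivable_within_continuous => s _; have [] := d1 s.
have [xi xih E] := second_difference_mean h0 cf (fun s _ => d1 s) (fun s _ => d2 s).
exists xi; first by move: xih; rewrite in_itv /= sub0r add0r.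
have fE s : rescaled T F t (x + s *: delta_mx 0 i) = f s by rewrite /rescaled -rE.
have -> : x - h *: delta_mx 0 i = x + (- h) *: delta_mx 0 i by rewrite scaleNr.
rewrite !fE.
have -> : rescaled T F t x = f 0 by rewrite -fE scale0r addr0.
move: E; rewrite add0r sub0r => ->; rewrite /f2 /rescaled_xx /rescaled -rE !mxE !eqxx.
by rewrite mulr1.
Qed.

Lemma rescaled_xx_continuous (T' : R) (i : 'I_n) :
  strip_continuous T' (rescaled_xx T Fr Frr i).
Proof.
have cr : strip_continuous T' (@rescaled R n T Fr) by apply: rescaled_continuous => /=; tauto.
have crr : strip_continuous T' (@rescaled R n T Frr) by apply: rescaled_continuous => /=; tauto.
have cc (a : R) : strip_continuous T' (fun _ (_ : 'rV[R]_n) => a).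
  by apply: strip_continuous_time => t t0; exact: cvg_cst.
have cx : strip_continuous T' (fun _ (x : 'rV[R]_n) => 2 * x 0 i / T ^+ 2).
  apply: strip_continuousM => //; apply: strip_continuousM => //.
  apply: continuous_subspaceT => z.
  apply: (@continuous_comp _ _ _ snd (fun y : 'rV[R]_n => y 0 i)); first exact: cvg_snd.
  exact: coord_continuous.
apply: strip_continuousD; last exact: strip_continuousM.
by apply: strip_continuousM => //; exact (strip_continuousM cx cx).
Qed.

Lemma rescaled_tt_continuous (T' : R) : strip_continuous T' (@rescaled_tt R n T Fss).
Proof.
apply: strip_continuousM; first by apply: rescaled_continuous => /=; tauto.
by apply: strip_continuous_time => t t0; exact: cvg_cst.
Qed.

(** The potential is scale invariant, [c / (1 + t)^2 = c / (s^2 T^2)], so the whole operator scales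
    by [T^-2]. *)
Lemma rescaled_wave (al : R) (t : R) (x : 'rV[R]_n) : 0 <= t ->
  rescaled_tt T Fss t x - \sum_(i < n) rescaled_xx T Fr Frr i t x
    + - (al * (al - 1)) / (1 + t) ^+ 2 * rescaled T F t x =
  epd_operator al n F Fss Fr Frr ((1 + t) / T) (radius_weight T x) / T ^+ 2.
Proof.
move=> t0; have Tn : T != 0 by rewrite gt_eqF.
have t1 : 1 + t != 0 by rewrite gt_eqF; lra.
have -> : \sum_(i < n) rescaled_xx T Fr Frr i t x =
   rescaled T Frr t x * 4 * (radius_weight T x - 1) / T ^+ 2
   + n%:R * (rescaled T Fr t x * (2 / T ^+ 2)).
  rewrite big_split /= sumr_const card_ord; congr (_ + _); last by rewrite [RHS]mulr_natl.
  rewrite /radius_weight addrAC subrr add0r.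
  have -> : rescaled T Frr t x * 4 * ((\sum_(i < n) x 0 i ^+ 2) / T ^+ 2) / T ^+ 2 =
     rescaled T Frr t x * 4 / T ^+ 4 * \sum_(i < n) x 0 i ^+ 2 by field.
  by rewrite mulr_sumr; apply: eq_bigr => i _; field.
rewrite /epd_operator /rescaled_tt /rescaled natrM.
by field; rewrite Tn t1.
Qed.

End Rescaled.

(** Young's inequality with [A = f (1 + t)^(- mu (p - 1) / 2)]. The remainder is
    [T^(- 2 - 2 / (p - 1)) (1 + t)^(mu / 2)] times the quantity controlled by the hypothesis on
    [e]. *)
Lemma nonlinear_young (R : realType) (n : nat) (mu p T t f e r C y : R) : 1 < p -> 2 <= T ->
  0 <= t -> t <= T / 2 -> 0 < r -> 0 <= C ->
  (f = 0 /\ e = 0) \/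
    (0 < f /\ `|e| * (`|e| / f) `^ (p - 1)^-1 <= C * ((1 + t) / T) `^ `|mu / 2| * r^-1 ^+ n) ->
  `|y| * (`|e| / T ^+ 2) <= f * ((1 + t) `^ (- (mu / 2 * (p - 1))) * `|y| `^ p)
    + C * T `^ (mu / 2 - 2 - 2 * (p - 1)^-1) * r^-1 ^+ n.
Proof.
move=> p1 T2 t0 tT r0 C0 [[-> ->]|[f0 he]].
  by rewrite normr0 !mul0r mulr0 add0r !mulr_ge0 ?powR_ge0// exprn_ge0// invr_ge0 ltW.
have T0 : 0 < T by lra.
have s0 : 0 < 1 + t by lra.
have q0 : 0 < p - 1 by lra.
have W0 : 0 < (1 + t) `^ (- (mu / 2 * (p - 1))) by rewrite powR_gt0.
have e0 : 0 <= `|e| / T ^+ 2 by rewrite divr_ge0// exprn_ge0// ltW.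
have A0 : 0 < f * (1 + t) `^ (- (mu / 2 * (p - 1))) by rewrite mulr_gt0.
apply: le_trans (powR_young p1 (normr_ge0 y) e0 A0) _.
rewrite -mulrA lerD2l.
pose ka := (p - 1)^-1.
have TE : T ^+ 2 = T `^ 2 by rewrite -powR_mulrn// ltW.
have splitE : (`|e| / T ^+ 2 / (f * (1 + t) `^ (- (mu / 2 * (p - 1))))) `^ ka =
   (`|e| / f) `^ ka * (T `^ (- 2 * ka) * (1 + t) `^ (mu / 2)).
  have -> : `|e| / T ^+ 2 / (f * (1 + t) `^ (- (mu / 2 * (p - 1)))) =
    (`|e| / f) * (T `^ (- 2) * (1 + t) `^ (mu / 2 * (p - 1))).
    rewrite !powRN -TE; field.
    by rewrite !gt_eqF// ?exprn_gt0// powR_gt0.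
  have ef0 : 0 <= `|e| / f := divr_ge0 (normr_ge0 _) (ltW f0).
  rewrite (powRM _ ef0 (mulr_ge0 (powR_ge0 _ _) (powR_ge0 _ _))).
  rewrite (powRM _ (powR_ge0 T _) (powR_ge0 (1 + t) _)) -!powRrM; congr (_ * (_ * _ `^ _)).
  by rewrite /ka -mulrA divff ?mulr1// gt_eqF.
rewrite splitE.
have -> : `|e| / T ^+ 2 * ((`|e| / f) `^ ka * (T `^ (- 2 * ka) * (1 + t) `^ (mu / 2))) =
   (T `^ (-2) * T `^ (- 2 * ka) * (1 + t) `^ (mu / 2)) * (`|e| * (`|e| / f) `^ ka).
  by rewrite powRN -TE; field; rewrite gt_eqF.
(* With [s = (1 + t) / T <= 1] the left side is [T^(mu / 2) s^(mu / 2 + |mu / 2|)], and the exponent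
   of [s] is nonnegative whatever the sign of [mu]. This is why the test function is required to
   gain [s^|mu / 2|]. *)
have h1 : (1 + t) `^ (mu / 2) * ((1 + t) / T) `^ `|mu / 2| <= T `^ (mu / 2).
  have sT : (1 + t) / T <= 1 by rewrite ler_pdivrMr// mul1r; lra.
  have sT0 : 0 < (1 + t) / T by rewrite divr_gt0.
  have -> : (1 + t) `^ (mu / 2) = T `^ (mu / 2) * ((1 + t) / T) `^ (mu / 2).
    by rewrite -powRM ?(ltW T0) ?(ltW sT0)// [T * _]mulrC divfK// gt_eqF.
  rewrite -mulrA -powRDp// ler_piMr ?powR_ge0//.
  apply: (@le_trans _ _ (((1 + t) / T) `^ 0)); last by rewrite powRr0.
  apply: ger_powR; first by rewrite sT0.
  by have := ler_norm (- (mu / 2)); rewrite normrN; lra.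
have P0 : 0 <= T `^ (-2) * T `^ (- 2 * ka) by rewrite mulr_ge0// powR_ge0.
have r0' : 0 <= r^-1 ^+ n by rewrite exprn_ge0// invr_ge0 ltW.
apply: (@le_trans _ _ (T `^ (-2) * T `^ (- 2 * ka) * (1 + t) `^ (mu / 2) *
  (C * ((1 + t) / T) `^ `|mu / 2| * r^-1 ^+ n))).
  by rewrite ler_wpM2l// mulr_ge0// powR_ge0.
have -> : T `^ (mu / 2 - 2 - 2 * ka) = T `^ (-2) * T `^ (- 2 * ka) * T `^ (mu / 2).
  by rewrite -!powRDp//; congr (_ `^ _); ring.
have -> : T `^ (-2) * T `^ (- 2 * ka) * (1 + t) `^ (mu / 2) *
  (C * ((1 + t) / T) `^ `|mu / 2| * r^-1 ^+ n) =
  (T `^ (-2) * T `^ (- 2 * ka)) * ((1 + t) `^ (mu / 2) * ((1 + t) / T) `^ `|mu / 2|) * (C * r^-1 ^+ n).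
  by ring.
have -> : C * (T `^ (-2) * T `^ (- 2 * ka) * T `^ (mu / 2)) * r^-1 ^+ n =
  (T `^ (-2) * T `^ (- 2 * ka)) * T `^ (mu / 2) * (C * r^-1 ^+ n) by ring.
by rewrite ler_wpM2r ?mulr_ge0// ler_wpM2l.
Qed.

Lemma le_of_forall_pos (R : realType) (a b L : R) : 0 <= L ->
  (forall eta, 0 < eta -> a <= b + L * eta) -> a <= b.
Proof.
move=> L0 h; apply/ler_addgt0Pr => e e0.
have L1 : 0 < L + 1 by lra.
apply: le_trans (h (e / (L + 1)) _) _; first by rewrite divr_gt0.
rewrite lerD2l mulrA ler_pdivrMr//; nra.
Qed.

Lemma enorm_le_radius (R : realType) (n : nat) (T : R) (x : 'rV[R]_n) : (0 < n)%N -> 0 < T ->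
  (forall i, `|x 0 i| <= T / n%:R) -> enorm x <= T /\ radius_weight T x <= 2.
Proof.
move=> n0 T0 hx; have nR : 1 <= n%:R :> R by rewrite ler1n.
have s : \sum_(i < n) x 0 i ^+ 2 <= T ^+ 2.
  apply: (@le_trans _ _ (\sum_(i < n) (T / n%:R) ^+ 2)).
    by apply: ler_sum => i _; rewrite -real_normK ?num_real// lerXn2r ?nnegrE// (le_trans _ (hx i)).
  rewrite sumr_const card_ord -[leLHS]mulr_natl.
  have -> : n%:R * (T / n%:R) ^+ 2 = T ^+ 2 / n%:R by field; rewrite gt_eqF//; lra.
  by rewrite ler_pdivrMr ?ler_peMr ?sqr_ge0//; lra.
split.
  apply: (@le_trans _ _ (Num.sqrt (T ^+ 2))); first exact: ler_wsqrtr.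
  by rewrite sqrtr_sqr gtr0_norm.
rewrite /radius_weight; have : (\sum_(i < n) x 0 i ^+ 2) / T ^+ 2 <= 1.
  by rewrite ler_pdivrMr ?exprn_gt0// mul1r.
lra.
Qed.

Lemma discrete_wave_close (R : realType) (n : nat) (d eta : R) (c : R -> R) (u utt : R -> 'rV[R]_n -> R)
    (uxx : 'I_n -> R -> 'rV[R]_n -> R) (t : R) (x : 'rV[R]_n) :
  `|second_diff_t d u t x - utt t x| < eta ->
  (forall i, `|second_diff_x d u i t x - uxx i t x| < eta) ->
  `|discrete_wave d u c t x - (utt t x - \sum_(i < n) uxx i t x + c t * u t x)| <= n.+1%:R * eta.
Proof.
move=> ht hx; rewrite /discrete_wave.
have -> : second_diff_t d u t x - \sum_(i < n) second_diff_x d u i t x + c t * u t x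
    - (utt t x - \sum_(i < n) uxx i t x + c t * u t x) =
  (second_diff_t d u t x - utt t x) - \sum_(i < n) (second_diff_x d u i t x - uxx i t x).
  by rewrite sumrB; ring.
apply: le_trans (ler_normB _ _) _.
rewrite -natr1 mulrDl mul1r addrC lerD ?(ltW ht)//.
apply: le_trans (ler_norm_sum _ _ _) _.
apply: le_trans (ler_sum _ (fun i _ => ltW (hx i))) _.
by rewrite sumr_const card_ord -[leLHS]mulr_natl.
Qed.

Lemma lattice_point_le (R : realType) (n M : nat) (d : R) (m : idx n M) (i : 'I_n) : 0 < d ->
  `|lattice_point d m 0 i| <= d * (M%:R + 1).
Proof.
move=> d0; rewrite mxE normrM (gtr0_norm d0) ler_wpM2l ?(ltW d0)//.
have : (m i)%:R <= (2 * M).+1%:R :> R by rewrite ler_nat -ltnS ltn_ord.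
have : 0 <= (m i)%:R :> R by [].
by rewrite -natr1 natrM ler_norml; lra.
Qed.

(** Meshes that divide a given length exactly are still arbitrarily small, so the final time and the
    sides of the cube can be lattice lengths. *)
Lemma near_small_mesh (R : realType) (a : R) (P : set R) : 0 < a -> (\forall d \near (0:R)^'+, P d) ->
  exists2 j : nat, (0 < j)%N & P (a / j%:R).
Proof.
move=> a0 /nbhs_ballP[r /= r0 hr].
exists (Num.truncn (a / r)).+1 => //.
have h := truncnS_gt (a / r).
have j0 : 0 < (Num.truncn (a / r)).+1%:R :> R by [].
have q0 : 0 < a / (Num.truncn (a / r)).+1%:R by rewrite divr_gt0.
apply: hr => //; rewrite /ball /= sub0r normrN gtr0_norm// ltr_pdivrMr//.
by rewrite mulrC -ltr_pdivrMr.
Qed.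

(** With [d = T / (2 n j)], [n j] steps make up the time [T / 2], [2 j] steps make up the side
    [T / n] of a cube on which [|x| <= T], and [n j N] steps reach the half-width [T N / 2 >= T^2]
    of the box. *)
Lemma mesh_facts (R : realType) (n j N : nat) (T d : R) :
  (2 <= n)%N -> (0 < j)%N -> 16 <= T -> 2 * T <= N%:R -> d = T / (2 * n%:R) / j%:R ->
  let J := (n * j).-1 in
  [/\ 0 < d <= T / 4, d * J.+1%:R = T / 2, d * J%:R = T / 2 - d,
      d * (n * j * N)%:R = T * N%:R / 2 &
      (2 * j <= n * j * N)%N /\ d * (2 * j)%:R = T / n%:R].
Proof.
move=> n2 j0 T16 hN dE J.
have nR : 2 <= n%:R :> R by rewrite (ler_nat R 2).
have jR : 1 <= j%:R :> R by rewrite ler1n.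
have J1 : J.+1 = (n * j)%N by rewrite /J prednK// muln_gt0 j0 andbT; clear -n2; lia.
have d0 : 0 < d by rewrite dE !divr_gt0// ?mulr_gt0//; lra.
have nz : n%:R != 0 :> R by rewrite gt_eqF//; lra.
have jz : j%:R != 0 :> R by rewrite gt_eqF//; lra.
have Jd : n%:R * j%:R * d = T / 2 by rewrite dE; field; rewrite nz jz.
have J1R : d * J.+1%:R = T / 2 by rewrite J1 natrM mulrC.
split => //.
- rewrite d0/=; have : 2 * 1 <= n%:R * j%:R :> R by rewrite ler_pM.
  clear -Jd d0; nra.
- by move: J1R; rewrite -natr1; clear; lra.
- by rewrite !natrM mulrA mulrC [d * _]mulrC Jd mulrC mulrAC.
split; last by rewrite natrM dE; field; rewrite nz jz.
rewrite -mulnA; apply: leq_mul => //.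
by rewrite leq_pmulr// -(ltr_nat R); apply: lt_le_trans hN; lra.
Qed.

(** The left side is the data on the cube of side [T / n], where [|x| <= T] and the test function is
    at least [c0]. The right side is the Young remainder over a time [T / 2], with [(8 T)^n]
    bounding the weighted volume. Both are limits of lattice sums. *)
Lemma lattice_estimate (R : realType) (n : nat) (al mu p k T eps M0 K C c0 : R)
    (F Fs Fss Fr Frr : R -> R -> R) (G : 'rV[R]_n -> R)
    (u ut utt : R -> 'rV[R]_n -> R) (uxx : 'I_n -> R -> 'rV[R]_n -> R) :
  (2 <= n)%N -> 1 < p -> 0 < M0 -> -1 < k -> 0 < eps -> 4 <= K -> 4 * K <= T -> 0 < C -> 0 < c0 ->
  slicewise_C2 F Fs Fss Fr Frr ->
  (forall s r : R, 0 < s -> 1 <= r -> 0 <= F s r) ->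
  (forall s r : R, 1 <= K * (s * r) -> F s r = 0) ->
  (forall s r : R, 0 < s -> 1 <= r <= 2 -> K * s <= 4^-1 -> c0 <= F s r) ->
  (forall s r : R, 0 < s -> 1 <= r ->
      let E := epd_operator al n F Fss Fr Frr s r in
      (F s r = 0 /\ E = 0) \/
      (0 < F s r /\ `|E| * (`|E| / F s r) `^ (p - 1)^-1 <= C * s `^ `|mu / 2| * r^-1 ^+ n)) ->
  (forall x, M0 / (1 + enorm x) `^ (k + 1) <= G x) ->
  wave_solution (- (al * (al - 1))) p (- (mu / 2 * (p - 1))) T (fun x => eps * G x) u ut utt uxx ->
  eps * (M0 / (2 * T) `^ (k + 1) * c0) * (T / n%:R) ^+ n <=
  T / 2 * (C * T `^ (mu / 2 - 2 - 2 * (p - 1)^-1) * (8 * T) ^+ n).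
Proof.
move=> n2 p1 M00 k1 eps0 K4 KT C0 c00 dF Fpos Fzero Flow Ferr hG
  [utt_mean ut_mean uxx_mean cu cut cutt cuxx ueq u0 u1].
have T16 : 16 <= T by lra.
have T0 : 0 < T by lra.
have [Tge0 Mge0 cge0] : [/\ 0 <= T, 0 <= M0 & 0 <= c0] by rewrite !ltW.
have nR : 2 <= n%:R :> R by rewrite (ler_nat R 2).
(* This choice gives [L >= T^2]. For [|x_i| >= T^2] one has [rho >= T^2], while [s >= 1 / T], so
   [K s rho >= 1] and [psi] vanishes. *)
have [N hN] : exists N : nat, 2 * T <= N%:R.
  by exists (Num.truncn (2 * T)).+1; apply: ltW; exact: truncnS_gt.
(* The solution is used up to [T / 2] only, and [psi] vanishes from [T / 4] on. [X] exceeds [L] in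
   order to include the outermost lattice layer, at distance [d (M + 1)]. *)
pose T' := T / 2. pose L := T * N%:R / 2. pose X := L + T.
have TT : T' < T by rewrite /T'; lra.
pose psi := @rescaled R n T F.
pose psi_tt := @rescaled_tt R n T Fss.
pose psi_xx := @rescaled_xx R n T Fr Frr.
have cpsi : strip_continuous T psi by apply: (rescaled_continuous T0 dF) => /=; tauto.
have LT : T ^+ 2 <= L by rewrite /L expr2; nra.
have [Bu Bu0 hBu] := strip_bounded X TT cu.
have [B B0 hB] := strip_bounded X TT cpsi.
have psi0 (t : R) (x : 'rV[R]_n) : 0 <= t -> 0 <= psi t x.
  move=> t0; apply: Fpos; last exact: radius_weight_ge1.
  by rewrite divr_gt0//; lra.
have psi_supp (t : R) (x : 'rV[R]_n) : 0 <= t -> (exists i : 'I_n, L <= `|x 0 i|) -> psi t x = 0.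
  move=> t0 [i hi]; apply: Fzero.
  have rT : T ^+ 2 <= radius_weight T x.
    rewrite /radius_weight (bigD1 i)//=.
    have : T ^+ 2 <= x 0 i ^+ 2 / T ^+ 2.
      rewrite ler_pdivlMr ?exprn_gt0// -expr2 -[leRHS]real_normK ?num_real//.
      by rewrite lerXn2r ?nnegrE ?sqr_ge0// (le_trans LT).
    have : 0 <= (\sum_(j < n | j != i) x 0 j ^+ 2) / T ^+ 2.
      by rewrite divr_ge0 ?sqr_ge0// sumr_ge0// => j _; exact: sqr_ge0.
    by rewrite mulrDl; lra.
  have sT : T^-1 <= (1 + t) / T by rewrite -[leLHS]mul1r ler_wpM2r ?invr_ge0 ?(ltW T0)// lerDl.
  have : T^-1 * T ^+ 2 <= (1 + t) / T * radius_weight T x.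
    by rewrite ler_pM ?invr_ge0 ?exprn_ge0 ?(ltW T0).
  rewrite expr2 mulKf ?gt_eqF// => h; nra.
have psi_late (t : R) (x : 'rV[R]_n) : T / 4 <= t -> psi t x = 0.
  move=> t4; apply: Fzero.
  have : 4^-1 <= (1 + t) / T by rewrite ler_pdivlMr//; lra.
  have := radius_weight_ge1 T x; set s := (1 + t) / T; set r := radius_weight T x => r1 s4.
  have : 4^-1 * 1 <= s * r by rewrite ler_pM.
  nra.
pose Cb := C * T `^ (mu / 2 - 2 - 2 * (p - 1)^-1).
have Cb0 : 0 <= Cb by rewrite mulr_ge0 ?powR_ge0// ltW.
pose Lam := 2 * L + 2 * T.
have Lam0 : 0 <= Lam by rewrite /Lam; have := le_trans (exprn_ge0 2 Tge0) LT; lra.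
pose c1 := M0 / (2 * T) `^ (k + 1) * c0.
have c10 : 0 <= c1 by rewrite !mulr_ge0 ?invr_ge0 ?powR_ge0.
apply: (@le_of_forall_pos _ _ _ (B * Lam ^+ n + T / 2 * (Lam ^+ n * (n.+1%:R * (1 + Bu) * (1 + B))))).
  have LL : 0 <= Lam ^+ n by rewrite exprn_ge0.
  have BB : 0 <= n.+1%:R * (1 + Bu) * (1 + B).
    by apply: mulr_ge0; [apply: mulr_ge0 => //|]; exact: addr_ge0.
  apply: addr_ge0; first exact: mulr_ge0.
  by apply: mulr_ge0; [rewrite divr_ge0|exact: mulr_ge0].
move=> eta eta0.
have [] := @near_small_mesh R (T / (2 * n%:R)) (fun d => 
  [/\ forall t (x : 'rV[R]_n), 0 <= t - d -> t + d <= T' -> (forall i, `|x 0 i| <= X) ->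
      `|second_diff_t d u t x - utt t x| < eta,
    forall i t (x : 'rV[R]_n), 0 <= t <= T' -> (forall i, `|x 0 i| <= X) ->
      `|second_diff_x d u i t x - uxx i t x| < eta,
    forall t (x : 'rV[R]_n), 0 <= t - d -> t + d <= T' -> (forall i, `|x 0 i| <= X) ->
      `|second_diff_t d psi t x - psi_tt t x| < eta,
    forall i t (x : 'rV[R]_n), 0 <= t <= T' -> (forall i, `|x 0 i| <= X) ->
      `|second_diff_x d psi i t x - psi_xx i t x| < eta &
    forall x : 'rV[R]_n, d <= T' -> (forall i, `|x 0 i| <= X) ->
      `|u d x / d - ut 0 x| < eta]).
  by rewrite divr_gt0// mulr_gt0//; lra.
- have e1 := second_diff_t_approx X TT utt_mean cutt eta0.
  have e2 : \forall d \near (0:R)^'+, forall i t (x : 'rV[R]_n), 0 <= t <= T' ->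
      (forall i, `|x 0 i| <= X) -> `|second_diff_x d u i t x - uxx i t x| < eta.
    apply: filter_forall => i.
    by apply: (second_diff_x_approx X TT _ (cuxx i) eta0) => t h x; exact: uxx_mean.
  have e3 : \forall d \near (0:R)^'+, forall t (x : 'rV[R]_n), 0 <= t - d -> t + d <= T' ->
      (forall i, `|x 0 i| <= X) -> `|second_diff_t d psi t x - psi_tt t x| < eta.
    have hm (t h : R) (x : 'rV[R]_n) : 0 < h -> 0 <= t - h -> t + h < T ->
        exists2 xi, t - h < xi < t + h &
        psi (t + h) x - 2 * psi t x + psi (t - h) x = h ^+ 2 * psi_tt xi x.
      by move=> h0 th _; exact: (rescaled_tt_mean T0 dF).
    have hc : strip_continuous T psi_tt by exact: (rescaled_tt_continuous T0 dF).
    exact: (second_diff_t_approx X TT hm hc eta0).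
  have e4 : \forall d \near (0:R)^'+, forall i t (x : 'rV[R]_n), 0 <= t <= T' ->
      (forall i, `|x 0 i| <= X) -> `|second_diff_x d psi i t x - psi_xx i t x| < eta.
    apply: filter_forall => i.
    have hm (t h : R) (x : 'rV[R]_n) : 0 <= t < T -> 0 < h -> exists2 xi, - h < xi < h &
        psi t (x + h *: delta_mx 0 i) - 2 * psi t x + psi t (x - h *: delta_mx 0 i) =
          h ^+ 2 * psi_xx i t (x + xi *: delta_mx 0 i).
      by move=> /andP[t0 _] h0; exact: (rescaled_xx_mean T0 dF).
    have hc : strip_continuous T (psi_xx i) by exact: (rescaled_xx_continuous T0 dF).
    exact: (second_diff_x_approx X TT hm hc eta0).
  have e5 := first_diff_approx X TT ut_mean cut eta0.
  by near=> d; split; near: d.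
move=> J' J'0; set d := _ / J'%:R => -[E1 E2 E3 E4 E5].
pose J := (n * J').-1; pose M := (n * J' * N)%N.
have [/andP[d0 dT4] J1R JR dM [hP dP]] := mesh_facts n2 J'0 T16 hN (erefl d).
rewrite -/J -/M -/L in J1R JR dM hP.
have latX (m : idx n M) i : `|lattice_point d m 0 i| <= X.
  by apply: le_trans (lattice_point_le m i d0) _; rewrite mulrDr dM mulr1 lerD2l; clear -dT4 T0; lra.
have supp t : 0 <= t -> box_supported (d * M%:R) (psi t).
  by move=> t0 x; rewrite dM; exact: psi_supp.
have psiB (t : R) x : 0 <= t <= T' -> psi t x <= B.
  move=> /andP[t0 tT]; have [h|h] := pselect (exists i : 'I_n, L <= `|x 0 i|).
    by rewrite psi_supp.
  apply: le_trans (ler_norm _) _; apply: hB; first by rewrite t0.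
  move=> i; rewrite leNgt; apply/negP => hi; apply: h; exists i.
  by apply: ltW; apply: le_lt_trans hi; rewrite /X lerDl.
have tj j : (1 <= j <= J)%N -> [/\ 0 <= d * j%:R - d, d * j%:R + d <= T' & 0 <= d * j%:R <= T'].
  move=> /andP[j1 jJ].
  have h1 : 1 <= j%:R :> R by rewrite ler1n.
  have h2 : j%:R <= J%:R :> R by rewrite ler_nat.
  have h3 : d * j%:R <= T / 2 - d by rewrite -JR ler_wpM2l// ltW.
  have h4 : d * 1 <= d * j%:R by rewrite ler_wpM2l// ltW.
  have h5 : d * j%:R + d <= T / 2 by clear -h3; lra.
  have h6 : 0 <= d * j%:R - d by clear -h4; lra.
  by rewrite /T'; split => //; clear -h4 h5 d0; lra.
pose c (t : R) := - (al * (al - 1)) / (1 + t) ^+ 2.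
pose NL (t : R) (x : 'rV[R]_n) := (1 + t) `^ (- (mu / 2 * (p - 1))) * `|u t x| `^ p.
pose b (x : 'rV[R]_n) := Cb * (radius_weight T x)^-1 ^+ n.
(* One error serves both comparisons: the discretization of the equation for [u], and that of
   [E(psi)] multiplied by [|u| <= Bu]. *)
pose eta1 := n.+1%:R * eta * (1 + Bu).
have eta10 : 0 <= eta1 by apply: mulr_ge0; [rewrite mulr_ge0// ltW|exact: addr_ge0].
have nle : n.+1%:R * eta <= eta1.
  by rewrite /eta1 ler_peMr ?lerDl// mulr_ge0// ltW.
have nle' : Bu * (n.+1%:R * eta) <= eta1.
  by rewrite /eta1 mulrC ler_wpM2l ?lerDr// mulr_ge0// ltW.
have main := @discrete_blowup_bound R n M J d eta1 B u psi NL c b d0 eta10 supp u0.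
have {main} main : (\sum_(m : idx n M) u d (lattice_point d m) * psi 0 (lattice_point d m)) / d ^+ 2 <=
  J%:R * (\sum_(m : idx n M) b (lattice_point d m))
    + J%:R * ((2 * M).+2 ^ n)%:R * (eta1 * (1 + B)).
  apply: main.
  - by move=> x; apply: psi_late; rewrite JR; clear -dT4; lra.
  - by move=> x; apply: psi_late; rewrite J1R; clear -T0; lra.
  - move=> j x hj; have [_ _ /andP[h1 h2]] := tj _ hj.
    by rewrite psi0// psiB// h1.
  - move=> j m hj t x _; have [h1 h2 h3] := tj _ hj.
    have tT : 0 <= t < T by case/andP: h3 => -> h; exact: le_lt_trans h TT.
    have := @discrete_wave_close R n d eta c u utt uxx t x
      (E1 _ _ h1 h2 (latX m)) (fun i => E2 i _ _ h3 (latX m)).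
    by rewrite ler_norml ueq// -/(NL t x) => /andP[h4 _]; move: h4 nle; clear; lra.
  - move=> j m hj; cbv zeta; set t := d * j%:R; set x := lattice_point d m.
    have [h1 h2 h3] := tj _ hj.
    have t0 : 0 <= t by case/andP: h3.
    have := @discrete_wave_close R n d eta c psi psi_tt psi_xx t x
      (E3 _ _ h1 h2 (latX m)) (fun i => E4 i _ _ h3 (latX m)).
    rewrite rescaled_wave//; set E := epd_operator _ _ _ _ _ _ _ _; set D := discrete_wave _ _ _ _ _ => hD.
    have r1 := radius_weight_ge1 T x.
    have st0 : 0 < (1 + t) / T by rewrite divr_gt0// ltr_pwDl.
    have uB : `|u t x| <= Bu by apply: hBu => //; exact: latX.
    have yg : `|u t x| * (`|E| / T ^+ 2) <= psi t x * NL t x + b x.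
      apply: (nonlinear_young (u t x) p1 _ t0 _ _ (ltW C0) (Ferr _ _ st0 r1)); first by clear -T16; lra.
        by case/andP: h3.
      exact: lt_le_trans r1.
    have -> : u t x * D = u t x * (E / T ^+ 2) + u t x * (D - E / T ^+ 2) by ring.
    apply: lerD.
      apply: le_trans yg; apply: le_trans (ler_norm _) _.
      by rewrite normrM normrM normfV (ger0_norm (exprn_ge0 _ Tge0)).
    apply: le_trans nle'; apply: le_trans (ler_norm _) _.
    by rewrite normrM ler_pM.
set V := ((2 * M).+2 ^ n)%:R in main.
have V0 : 0 <= V by rewrite /V.
have dV : d ^+ n * V <= Lam ^+ n.
  rewrite /V natrX -exprMn lerXn2r ?nnegrE ?mulr_ge0 ?(ltW d0)//.
  by rewrite -addn2 natrD natrM mulrDr mulrCA dM /Lam; clear -dT4 T0; lra.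
have weight_sum : d ^+ n * \sum_(m : idx n M) b (lattice_point d m) <= Cb * (8 * T) ^+ n.
  rewrite -mulr_sumr mulrCA ler_wpM2l//.
  have dTT : 0 < d <= T by rewrite d0/=; clear -dT4 T0; lra.
  apply: le_trans (ler_wpM2l (exprn_ge0 n (ltW d0)) (lattice_weight_sum n M dTT)) _.
  by rewrite -exprMn mulrC divfK// gt_eqF.
have low : d * (eps * (c1 * (2 * J')%:R ^+ n) - eta * B * V) <=
   \sum_(m : idx n M) u d (lattice_point d m) * psi 0 (lattice_point d m).
  have G0 x : 0 <= G x by apply: le_trans (hG x); rewrite divr_ge0// powR_ge0.
  (* On the cube, [1 + |x| <= 2 T] bounds the data from below. There [rho <= 2] and at [t = 0],
     [K s = K / T <= 1 / 4], so [psi >= c0]. *)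
  have lb : c1 * (2 * J')%:R ^+ n <= \sum_(m : idx n M) G (lattice_point d m) * psi 0 (lattice_point d m).
    apply: lattice_sum_lower_bound => //; first by move=> m; rewrite mulr_ge0// psi0.
    move=> m hm; set x := lattice_point d m.
    have hx i : `|x 0 i| <= T / n%:R.
      rewrite mxE; have /andP[m1 m2] := hm i.
      have h1 : M%:R <= (m i)%:R :> R by rewrite ler_nat.
      have h2 : (m i)%:R <= M%:R + 2 * J'%:R :> R by rewrite -natrM -natrD ler_nat ltnW.
      rewrite ger0_norm; last by rewrite mulr_ge0 ?(ltW d0)// subr_ge0.
      rewrite -dP natrM ler_wpM2l ?(ltW d0)//.
      by move: h2; clear; lra.
    have [hx1 hx2] := enorm_le_radius (ltnW n2) T0 hx.
    have w1 := radius_weight_ge1 T x.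
    apply: ler_pM => //; first by rewrite divr_ge0// powR_ge0.
      apply: le_trans (hG x); rewrite ler_wpM2l//.
      have x0 : 0 <= enorm x by exact: sqrtr_ge0.
      rewrite lef_pV2 ?posrE ?powR_gt0//; [|by clear -T0; lra|by clear -x0; lra].
      apply: ge0_ler_powR; rewrite ?nnegrE.
      + by clear -k1; lra.
      + by clear -x0; lra.
      + by clear -T0; lra.
      + by clear -hx1 T16; lra.
    apply: Flow; rewrite ?w1 ?hx2 ?addr0 ?mul1r ?invr_gt0//.
    by rewrite ler_pdivrMr//; clear -KT; lra.
  have -> : d * (eps * (c1 * (2 * J')%:R ^+ n) - eta * B * V) =
     d * eps * (c1 * (2 * J')%:R ^+ n) - \sum_(m : idx n M) d * (eta * B).
    by rewrite sumr_const card_lattice -[_ *+ (_ ^ _)]mulr_natr -/V; ring.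
  apply: (@le_trans _ _ (\sum_(m : idx n M) (d * eps * (G (lattice_point d m) * psi 0 (lattice_point d m)) - d * (eta * B)))).
    by rewrite sumrB lerD2r -mulr_sumr ler_wpM2l// mulr_ge0// ltW.
  apply: ler_sum => m _; set x := lattice_point d m.
  have dT' : d <= T' by rewrite /T'; clear -dT4 T0; lra.
  have := E5 x dT' (latX m); rewrite u1 ltr_norml => /andP[h1 _].
  have h2 : eps * G x - eta <= u d x / d by move: h1; clear; lra.
  have h3 : d * (eps * G x - eta) <= u d x by rewrite mulrC -ler_pdivlMr.
  have p0 := psi0 0 x (lexx 0).
  have pB : psi 0 x <= B by apply: psiB; rewrite lexx /T'; clear -T0; lra.
  apply: le_trans (ler_wpM2r p0 h3).
  have : d * eta * psi 0 x <= d * eta * B by rewrite ler_wpM2l// mulr_ge0// ltW.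
  clear; lra.
have dn0 : 0 <= d ^+ n by rewrite exprn_ge0// ltW.
have dJ : d * J%:R <= T / 2 by rewrite JR; clear -d0; lra.
have dJ0 : 0 <= d * J%:R by rewrite mulr_ge0// ltW.
have P1 : (T / n%:R) ^+ n = d ^+ n * (2 * J')%:R ^+ n.
  by rewrite -exprMn dP.
have main1 : eps * (c1 * (2 * J')%:R ^+ n) - eta * B * V <=
    d * J%:R * (\sum_(m : idx n M) b (lattice_point d m)) + d * J%:R * V * (eta1 * (1 + B)).
  rewrite -(ler_pM2l d0); apply: le_trans low _.
  move: main; rewrite ler_pdivrMr ?exprn_gt0// => h; apply: (le_trans h).
  by rewrite le_eqVlt; apply/orP; left; apply/eqP; ring.
(* The factor [d^n] turns lattice sums into Riemann sums, whose bounds are independent of the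
   mesh. *)
have main2 := ler_wpM2l dn0 main1.
rewrite [leRHS]mulrDr in main2.
have k1' : d ^+ n * (d * J%:R * (\sum_(m : idx n M) b (lattice_point d m))) <= T / 2 * (Cb * (8 * T) ^+ n).
  by rewrite mulrCA; apply: ler_pM => //; rewrite mulr_ge0// sumr_ge0// => m _; rewrite mulr_ge0// exprn_ge0// invr_ge0 (le_trans _ (radius_weight_ge1 _ _)).
have k2' : d ^+ n * (d * J%:R * V * (eta1 * (1 + B))) <=
   T / 2 * (Lam ^+ n * (n.+1%:R * (1 + Bu) * (1 + B))) * eta.
  have -> : d ^+ n * (d * J%:R * V * (eta1 * (1 + B))) =
    (d * J%:R) * (d ^+ n * V) * (n.+1%:R * (1 + Bu) * (1 + B) * eta) by rewrite /eta1; ring.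
  have -> : T / 2 * (Lam ^+ n * (n.+1%:R * (1 + Bu) * (1 + B))) * eta =
    (T / 2) * Lam ^+ n * (n.+1%:R * (1 + Bu) * (1 + B) * eta) by ring.
  apply: ler_pM => //; [by rewrite !mulr_ge0| |by apply: ler_pM => //; rewrite mulr_ge0].
  by rewrite !mulr_ge0 ?addr_ge0// ltW.
have k3' : d ^+ n * (eta * B * V) <= B * Lam ^+ n * eta.
  have -> : d ^+ n * (eta * B * V) = (d ^+ n * V) * (B * eta) by ring.
  have -> : B * Lam ^+ n * eta = Lam ^+ n * (B * eta) by ring.
  by rewrite ler_wpM2r// mulr_ge0// ltW.
rewrite -/Cb -/c1 P1 [(B * _ + _) * eta]mulrDl.
have -> : eps * c1 * (d ^+ n * (2 * J')%:R ^+ n) =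
  d ^+ n * (eps * (c1 * (2 * J')%:R ^+ n) - eta * B * V) + d ^+ n * (eta * B * V) by ring.
move: main2 k1' k2' k3'; clear.
set X1 := d ^+ n * (_ - _); set X2 := d ^+ n * (d * _ * _); set X3 := d ^+ n * (d * _ * _ * _).
set X4 := d ^+ n * _; set X5 := T / 2 * _; set X6 := B * _ * _; set X7 := _ * eta.
lra.
Unshelve. all: end_near. Qed.

(** The smaller root of [al^2 - al + c = 0]; it is nonpositive because the discriminant [1 - 4 c] is
    at least 1. *)
Lemma indicial_root (R : realType) (c : R) : c <= 0 ->
  exists2 al : R, al <= 0 & - (al * (al - 1)) = c.
Proof.
move=> c0; pose s := Num.sqrt (1 - 4 * c).
have s2 : s ^+ 2 = 1 - 4 * c by rewrite sqr_sqrtr//; lra.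
exists ((1 - s) / 2).
  have : Num.sqrt 1 <= s by rewrite ler_wsqrtr//; lra.
  by rewrite sqrtr1; lra.
have -> : - ((1 - s) / 2 * ((1 - s) / 2 - 1)) = (1 - s ^+ 2) / 4 by field.
by rewrite s2; field.
Qed.

(** Counting powers of [T]: the data side carries [n - k - 1], the error side
    [n - 1 + mu / 2 - 2 ka], and their difference is the exponent in the conclusion. *)
Lemma power_estimate (R : realType) (n : nat) (mu ka k T eps M0 C c0 : R) :
  (0 < n)%N -> 0 < T -> 0 < M0 -> 0 < C -> 0 < c0 ->
  eps * (M0 / (2 * T) `^ (k + 1) * c0) * (T / n%:R) ^+ n <=
    T / 2 * (C * T `^ (mu / 2 - 2 - 2 * ka) * (8 * T) ^+ n) ->
  eps * T `^ (2 * ka - k - mu / 2) <=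
    C * (8 * n%:R) ^+ n * 2 `^ (k + 1) / (2 * M0 * c0).
Proof.
move=> n0 T0 M00 C0 c00.
have nz : (n%:R : R) ^+ n != 0 by rewrite expf_neq0// pnatr_eq0 -lt0n.
have nzp : 0 < (n%:R : R) ^+ n by rewrite exprn_gt0// ltr0n.
have Tnz : 0 < T ^+ n by rewrite exprn_gt0.
rewrite exprMn exprVn exprMn (powRM _ (ler0n _ 2) (ltW T0)) exprMn.
set a := 2 `^ (k + 1); set N := n%:R ^+ n; set X := 8 ^+ n.
have a0 : 0 < a by rewrite powR_gt0.
have Tk : 0 < T `^ (k + 1) by rewrite powR_gt0.
have Zrel : T `^ (2 * ka - k - mu / 2) * (T * T `^ (mu / 2 - 2 - 2 * ka) * T `^ (k + 1)) = 1.
  rewrite -{2}(powRr1 (ltW T0)) -!powRDp// (_ : _ + _ = 0) ?powRr0//; ring.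
have Z0 : 0 < T `^ (2 * ka - k - mu / 2) by rewrite powR_gt0.
move: Zrel Tk Z0; set Tk1 := T `^ (k + 1); set Z := T `^ (2 * ka - k - mu / 2).
set E := T `^ _ => Zrel Tk Z0 h.
(* The multiplier that reduces the left side of the estimate to [eps Z]; by [Zrel] all powers of [T]
   then disappear from the right side. *)
pose q := a * Tk1 * N * Z / (M0 * c0 * T ^+ n).
have q0 : 0 <= q by rewrite ltW// divr_gt0// !mulr_gt0.
have -> : eps * Z = eps * (M0 / (a * Tk1) * c0) * (T ^+ n / N) * q.
  by rewrite /q; field; rewrite nz !gt_eqF.
have -> : C * (X * N) * a / (2 * M0 * c0) = T / 2 * (C * E * (X * T ^+ n)) * q.
  transitivity (C * (X * N) * a / (2 * M0 * c0) * (Z * (T * E * Tk1))).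
    by rewrite Zrel mulr1.
  by rewrite /q; field; rewrite !gt_eqF.
exact: ler_wpM2r.
Qed.

Theorem theorem1 (R : realType) (n : nat) (mu nu p : R) (g : R -> R) (M k : R)
  (hn : (2 <= n)%N) (hp : 1 < p)
  (hg : smooth (fun x : 'rV[R]_n => g (enorm x)))
  (hM : 0 < M) (hk : -1 < k)
  (hgM : forall x : 'rV[R]_n, M / (1 + enorm x) `^ (k + 1) <= g (enorm x))
  (hkmu : 0 < k + mu / 2)
  (hnu : nu <= mu / 2 * (mu / 2 - 1))
  (hpF : p < p_F (k + mu / 2)) :
  forall eps0 : R, 0 < eps0 ->
  exists C : R, 0 < C /\
  forall eps : R, 0 < eps <= eps0 ->
  let G := fun x : 'rV[R]_n => g (enorm x) in
  existence_times mu nu p G eps !=set0 ->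
  [/\ (0 < lifespan mu nu p G eps)%E,
      (lifespan mu nu p G eps < +oo)%E &
      (lifespan mu nu p G eps <=
        (C * eps `^ (- (2 * (p - 1) / (4 - (mu + 2 * k) * (p - 1)))))%:E)%E].
Proof.
move=> eps0 eps00.
have q0 : 0 < p - 1 by lra.
pose ka := (p - 1)^-1; have ka0 : 0 < ka by rewrite invr_gt0.
have [al al0 alE] : exists2 al : R, al <= 0 & - (al * (al - 1)) = nu - mu / 2 * (mu / 2 - 1).
  by apply: indicial_root; lra.
have [F [Fs [Fss [Fr [Frr [K [C [c0 [dF K4 C0 c00 [Fpos Fzero Flow Ferr]]]]]]]]]] :=
  test_function `|mu / 2| n al0 ka0.
(* Positivity of [th] is the subcriticality of [p], and [1 / th] is the exponent of the lifespan
   bound. *)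
pose th := 2 * ka - k - mu / 2.
have hth : (p - 1) * (k + mu / 2) < 2.
  by move: hpF; rewrite /p_F -ltrBlDl ltr_pdivlMr.
have th0 : 0 < th.
  have : k + mu / 2 < 2 * ka by rewrite ltr_pdivlMr// mulrC.
  by rewrite /th; lra.
have thE : 2 * (p - 1) / (4 - (mu + 2 * k) * (p - 1)) = th^-1.
  have den : 4 - (mu + 2 * k) * (p - 1) = 2 * (p - 1) * th.
    by rewrite /th /ka; field; rewrite gt_eqF.
  by rewrite den; field; rewrite !gt_eqF.
pose D := C * (8 * n%:R) ^+ n * 2 `^ (k + 1) / (2 * M * c0).
have D0 : 0 < D.
  have n0 : 0 < n%:R :> R by rewrite ltr0n; exact: ltnW.
  by rewrite divr_gt0// !mulr_gt0 ?exprn_gt0 ?powR_gt0 ?mulr_gt0.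
have K0 : 0 < K by lra.
have D1 : 0 < D `^ th^-1 by rewrite powR_gt0.
have e1 : 0 < eps0 `^ th^-1 by rewrite powR_gt0.
(* The two summands cover two regimes. For [T >= 4 K] the test function applies and gives the first.
   For [T < 4 K] the bound [4 K <= 4 K (eps0 / eps)^(1 / th)] gives the second; here [eps <= eps0]
   enters. *)
exists (D `^ th^-1 + 4 * K * eps0 `^ th^-1); split.
  by rewrite addr_gt0// !mulr_gt0.
move=> eps /andP[e0 ee0] G [T1 [T10 sol1]].
rewrite thE; set B := _ * eps `^ _.
(* The existence time itself is taken as the scale of the test function, so each element of the set
   is bounded directly and the supremum inherits the bound. *)
have bound T : existence_times mu nu p G eps T -> T <= B.
  move=> [T0 [v sol]].
  have ep : 0 < eps `^ (- th^-1) by rewrite powR_gt0.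
  have [TK|TK] := leP (4 * K) T; last first.
    apply: (le_trans (ltW TK)); rewrite /B [(D `^ _ + _) * _]mulrDl.
    have : 1 <= eps0 `^ th^-1 * eps `^ (- th^-1).
      rewrite powRN ler_pdivlMr ?powR_gt0// mul1r.
      by apply: ge0_ler_powR; rewrite ?nnegrE ?invr_ge0 ?(ltW th0) ?(ltW e0) ?(ltW eps00).
    move=> h; apply: (@le_trans _ _ (4 * K * (eps0 `^ th^-1 * eps `^ (- th^-1)))).
      by rewrite ler_peMr// mulr_ge0// ltW.
    by rewrite mulrA lerDr mulr_ge0// ltW.
  have [u [ut [utt [uxx wv]]]] := liouville_transform T0 sol.
  rewrite -alE in wv.
  have est := lattice_estimate hn hp hM hk e0 K4 TK C0 c00 dF Fpos Fzero Flow Ferr hgM wv.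
  have := power_estimate (ltnW hn) T0 hM C0 c00 est.
  rewrite -/ka -/th -/D => h.
  have TE : T = (T `^ th) `^ th^-1 by rewrite -powRrM divff ?powRr1 ?(ltW T0)// gt_eqF.
  apply: (@le_trans _ _ (D `^ th^-1 * eps `^ (- th^-1))); last first.
    by rewrite /B [(D `^ _ + _) * _]mulrDl lerDl !mulr_ge0// ?ltW.
  have -> : D `^ th^-1 * eps `^ (- th^-1) = (D / eps) `^ th^-1.
    rewrite -(powR_inv1 (ltW e0)) (powRM _ (ltW D0) (powR_ge0 _ _)).
    by rewrite -powRrM mulN1r.
  rewrite [leLHS]TE; apply: ge0_ler_powR.
  - by rewrite invr_ge0 ltW.
  - by rewrite nnegrE powR_ge0.
  - by rewrite nnegrE divr_ge0 ?(ltW D0) ?(ltW e0).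
  - by rewrite ler_pdivlMr// mulrC.
have le_B : (lifespan mu nu p G eps <= B%:E)%E.
  (* The element 0 adjoined to the set of times lies below [B] because the positive existence time
     [T1] does. *)
  apply: ge_ereal_sup => _ [->|[T hT <-]]; last by rewrite lee_fin; exact: bound.
  by rewrite lee_fin; apply: le_trans (bound T1 _); [exact: ltW|split].
split => //; last by apply: le_lt_trans le_B _; exact: ltry.
apply: (@lt_le_trans _ _ T1%:E); first by rewrite lte_fin.
by apply: ereal_sup_ubound; right; exists T1.
Qed.
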